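(* Let $p$ be a prime and $q=p^\lambda$ with $\lambda\ge1$. (1) Let $F$ be a field with $\mathbb F_q\subseteq F$. Then all elements of $\mathfrak{BD}^\ast_{q,0}$ may be expressed as a, possibly infinite, convergent product over those elements of $\mathfrak{BD}^\ast_{q,0}$ created out of only one nonzero additive function. (2) In particular, let $A=\mathbb F_q[\theta]$, let $\mathfrak v$ be a nontrivial prime of $A$ with completion $A_{\mathfrak v}$, and let $\alpha\in A_{\mathfrak v}$. Then one derives such a product decomposition for the Dirac measure $\delta_\alpha$, viewed as an element of $A_{\mathfrak v}\{\{\mathfrak D\}\}$. When $\alpha$ is not an element of $A$, this product decomposition has infinitely many terms. (3) This product decomposition corresponds measure theoretically to expressing $\delta_\alpha$ as an ''infinite convolution'' (a concept well known in classical measure theory).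
   Context: For a commutative unital ring $R$, $R\{\{\mathfrak D\}\}$ is the commutative ring of formal series $\sum_{i\ge0}a_i\mathfrak D_i$ ($a_i\in R$) with coefficientwise addition and multiplication determined by $\mathfrak D_i\cdot\mathfrak D_j=\binom{i+j}{j}\mathfrak D_{i+j}$; its unit is $\mathfrak D_0=1$. It is topologized by the descending chain of ideals $M_n=\{\sum_{i\ge n}a_i\mathfrak D_i\}$, for which it is complete; convergence is in this topology. A polynomial in $F[x]$ is $\mathbb F_q$-linear if it is a finite $F$-linear combination of monomials $x^{q^n}$, $n\ge0$; such polynomials are additive. For a sequence $E=\{e_t(x)\}_{t=0}^\infty$ of $\mathbb F_q$-linear polynomials in $F[x]$ and $i=\sum_t i_tq^t$ written $q$-adically ($0\le i_t<q$), put $p_{E,i}(x):=\prod_t e_t(x)^{i_t}$ (with $e_t(x)^0=1$) and $f_{P_E}(x):=\sum_{i\ge0}p_{E,i}(x)\mathfrak D_i\in F[x]\{\{\mathfrak D\}\}$. $\mathfrak{BD}^\ast_{q,0}$ is the set of all $f_{P_E}(x)$ as $E$ ranges over such sequences. An element of it is created out of only one nonzero additive function if it is $f_{P_E}(x)$ for a sequence $E$ with exactly one nonzero entry. For $A=\mathbb F_q[\theta]$ and $t\ge0$, let $e_t(x):=\prod_{a\in A,\,\deg(a)<t}(x-a)$ (the product including $a=0$ when $t\geq 1$, and $e_0(x)=x$), and let $D_t$ be the product of all monic elements of $A$ of degree $t$. The Carlitz polynomials are $G_i(x):=\prod_t\big(e_t(x)/D_t\big)^{i_t}$ for $i=\sum_t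 i_tq^t$ written $q$-adically; they are obtained from the sequence $\{e_t(x)/D_t\}$ by the construction above. They form an orthonormal Banach basis for the continuous functions from $A_{\mathfrak v}$ to itself, and the convolution algebra of $A_{\mathfrak v}$-valued nonarchimedean measures on $A_{\mathfrak v}$ is isomorphic to $A_{\mathfrak v}\{\{\mathfrak D\}\}$. The Dirac measure $\delta_\alpha$ is defined by $\int_{A_{\mathfrak v}}f(x)\,d\delta_\alpha(x)=f(\alpha)$ for all continuous $f$; under this isomorphism it corresponds to $\sum_i G_i(\alpha)\mathfrak D_i$. *)

(* Defs.v *)
From HB Require Import structures.
From mathcomp Require Import all_boot all_order all_algebra.
From mathcomp Require Import all_classical all_reals all_analysis.

Set Implicit Arguments.
Unset Strict Implicit.
Unset Printing Implicit Defensive.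

Import GRing.Theory.

Local Open Scope classical_set_scope.
Local Open Scope ring_scope.

(* The uniform structure on an abelian group defined by a descending chain    *)
(* of subgroups: I n is a base of neighborhoods of 0.                         *)
Section ChainUniformity.
Variables (V : zmodType) (I : nat -> set V).
Hypothesis I0 : forall n, I n 0.
Hypothesis IB : forall n x y, I n x -> I n y -> I n (x - y).
Hypothesis I_decr : forall m n, (m <= n)%N -> I n `<=` I m.

Definition chain_entourage : set_system (V * V) :=
  filter_from setT (fun n => [set xy | I n (xy.2 - xy.1)]).

Lemma chain_entourage_filter : Filter chain_entourage.
Proof.
apply: filter_from_filter; first by exists 0%N.
move=> m n _ _; exists (maxn m n) => // xy /= Ixy; split => /=.
  by apply: I_decr Ixy; rewrite leq_maxl.
by apply: I_decr Ixy; rewrite leq_maxr.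
Qed.

Local Open Scope relation_scope.

Lemma chain_entourage_diagonal A : chain_entourage A -> diagonal `<=` A.
Proof. by move=> [n _ nA] xy xyD; apply: nA; rewrite /= xyD subrr. Qed.

Lemma chain_entourage_inv A : chain_entourage A -> chain_entourage A^-1.
Proof.
move=> [n _ nA]; exists n => // -[x y] /= Ixy; apply: nA => /=.
by rewrite -opprB -sub0r; apply: IB.
Qed.

Lemma chain_entourage_split A : chain_entourage A ->
  exists2 B, chain_entourage B & B \; B `<=` A.
Proof.
move=> [n _ nA]; exists [set xy | I n (xy.2 - xy.1)]; first by exists n.
move=> [x y] [z /= Ixz Izy]; apply: nA => /=.
have -> : y - x = (y - z) - (0 - (z - x)).
  by rewrite sub0r opprK addrA subrK.
by apply: IB => //; apply: IB.
Qed.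

End ChainUniformity.

(* R{{D}}: the series \sum_i a_i D_i is the function i |-> a_i, and           *)
(* D_i * D_j = 'C(i + j, j) D_(i + j).                                        *)
Definition dpseries (R : Type) : Type := nat -> R.

Section DividedPowerSeries.
Variable R : comPzRingType.
Implicit Types f g h : dpseries R.

HB.instance Definition _ := GRing.Zmodule.copy (dpseries R) (nat -> R).

Definition dpone : dpseries R := fun n => (n == 0%N)%:R.

Definition dpmul f g : dpseries R :=
  fun n => \sum_(i < n.+1) (f i * g (n - i)%N) *+ 'C(n, i).

Lemma dpmulC : commutative dpmul.
Proof.
move=> f g; apply/funext => n; rewrite /dpmul (reindex_inj rev_ord_inj) /=.
apply: eq_bigr => i _; have lein : (i <= n)%N by rewrite -ltnS.
by rewrite subSS bin_sub // mulrC subKn.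
Qed.

Lemma dpmul_rev f g n :
  dpmul f g n = \sum_(i < n.+1) (f (n - i)%N * g i) *+ 'C(n, i).
Proof. by rewrite dpmulC; apply: eq_bigr => i _; rewrite mulrC. Qed.

Let bin_trade n j k : (j + k <= n)%N ->
  ('C(n, j) * 'C(n - j, k) = 'C(n, k) * 'C(n - k, j))%N.
Proof.
move=> jkn; have lejn := leq_trans (leq_addr k j) jkn.
have lekn := leq_trans (leq_addl j k) jkn.
have lek : (k <= n - j)%N by rewrite leq_subRL.
have lej : (j <= n - k)%N by rewrite leq_subRL // addnC.
apply/eqP; rewrite -(eqn_pmul2r (fact_gt0 j)) -(eqn_pmul2r (fact_gt0 k)).
rewrite -(eqn_pmul2r (fact_gt0 (n - j - k))); apply/eqP.
have E1 := bin_fact lejn; have E2 := bin_fact lekn.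
have E3 := bin_fact lek; have E4 := bin_fact lej.
have -> : ('C(n, j) * 'C(n - j, k) * j`! * k`! * (n - j - k)`! =
   'C(n, j) * (j`! * ('C(n - j, k) * (k`! * (n - j - k)`!))))%N.
  by rewrite -!mulnA; congr (_ * _)%N; rewrite mulnCA.
rewrite E3 E1.
have -> : ('C(n, k) * 'C(n - k, j) * j`! * k`! * (n - j - k)`! =
   'C(n, k) * (k`! * ('C(n - k, j) * (j`! * (n - k - j)`!))))%N.
  rewrite -!mulnA; congr (_ * _)%N; rewrite subnAC.
  by rewrite [in RHS]mulnCA; congr (_ * _)%N; rewrite mulnCA.
by rewrite E4 E2.
Qed.

Lemma dpmulA : associative dpmul.
Proof.
move=> f g h; apply/funext => n; rewrite {1}/dpmul dpmul_rev.
pose c3 j k := (f j * (g (n - j - k)%N * h k)) *+ ('C(n, j) * 'C(n - j, k)).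
transitivity (\sum_(j < n.+1) \sum_(k < n.+1 | (k <= n - j)%N) c3 j k).
  apply: eq_bigr => /= j _; rewrite dpmul_rev mulr_sumr -sumrMnl.
  rewrite (big_ord_narrow_leq (leq_subr _ _)) /=.
  by apply: eq_bigr => k _; rewrite mulrnAr -mulrnA mulnC.
rewrite (exchange_big_dep predT) //=; apply: eq_bigr => k _.
have lekn : (k <= n)%N by rewrite -ltnS.
transitivity (\sum_(j < n.+1 | (j <= n - k)%N) c3 j k).
  apply: eq_bigl => j; have lejn : (j <= n)%N by rewrite -ltnS.
  by rewrite !leq_subRL // addnC.
rewrite (big_ord_narrow_leq (leq_subr _ _)) mulr_suml -sumrMnl /=.
apply: eq_bigr => j _; have lej : (j <= n - k)%N by rewrite -ltnS.
rewrite /c3 /= bin_trade; last by rewrite addnC -leq_subRL.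
by rewrite mulrnAl -mulrnA mulnC subnAC mulrA.
Qed.

Lemma dpmul1 : left_id dpone dpmul.
Proof.
move=> f; apply/funext => n; rewrite /dpmul big_ord_recl /= big1 => [|i _].
  by rewrite addr0 mul1r subn0 bin0.
by rewrite mul0r mul0rn.
Qed.

Lemma dpmulDl : left_distributive dpmul +%R.
Proof.
move=> f g h; apply/funext => n; rewrite /dpmul /=.
rewrite [RHS](_ : _ = dpmul f h n + dpmul g h n) // -big_split /=.
by apply: eq_bigr => i _; rewrite -mulrnDl -mulrDl.
Qed.

HB.instance Definition _ := GRing.Zmodule_isComPzRing.Build (dpseries R)
  dpmulA dpmulC dpmul1 dpmulDl.

(* The ideals M_n. *)
Definition dpideal n : set (dpseries R) :=
  [set f | forall i, (i < n)%N -> f i = 0].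

Let dpideal0 n : dpideal n 0. Proof. by []. Qed.

Let dpidealB n f g : dpideal n f -> dpideal n g -> dpideal n (f - g).
Proof.
move=> f0 g0 i lt_in; rewrite [LHS](_ : _ = f i - g i) //.
by rewrite f0 // g0 // subr0.
Qed.

Let dpideal_decr m n : (m <= n)%N -> dpideal n `<=` dpideal m.
Proof. by move=> lemn f f0 i lt_im; apply: f0; apply: leq_trans lemn. Qed.

HB.instance Definition _ := isUniform.Build (dpseries R)
  (chain_entourage_filter dpideal_decr) (chain_entourage_diagonal dpideal0)
  (chain_entourage_inv dpideal0 dpidealB)
  (chain_entourage_split dpideal0 dpidealB).

Lemma nbhs_dpseriesP f (A : set (dpseries R)) :
  nbhs f A <-> exists n, [set g | dpideal n (g - f)] `<=` A.
Proof.
rewrite -nbhs_entourageE; split.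
  move=> [B [n _ nB] BA]; exists n => g Ifg; apply: BA.
  by apply/mem_set/nB.
move=> [n nA]; exists [set fg | dpideal n (fg.2 - fg.1)]; first by exists n.
by move=> g /set_mem /= Ifg; apply: nA.
Qed.

End DividedPowerSeries.

Section BinomialDividedPower.
Variables (q : nat) (F : fieldType).
Implicit Types (E : nat -> {poly F}) (f : dpseries {poly F}).

Definition qlinear (e : {poly F}) : Prop :=
  exists n (c : 'I_n -> F), e = \sum_(i < n) c i *: 'X^(q ^ i).

(* The t-th q-adic digit of i is (i %/ q ^ t) %% q; it vanishes for i < t     *)
(* when 1 < q.                                                                *)
Definition pE E (i : nat) : {poly F} :=
  \prod_(t < i.+1) E t ^+ ((i %/ q ^ t) %% q)%N.

Definition fPE E : dpseries {poly F} := fun i => pE E i.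

Definition BD : set (dpseries {poly F}) :=
  [set f | exists2 E, (forall t, qlinear (E t)) & f = fPE E].

Definition BD_single : set (dpseries {poly F}) :=
  [set f | exists E,
    [/\ forall t, qlinear (E t), exists! t, E t <> 0 & f = fPE E]].

End BinomialDividedPower.

(* The sequence keeping only the entry of index t of E. *)
Definition only (V : zmodType) (E : nat -> V) (t : nat) : nat -> V :=
  fun s => if s == t then E t else 0.

(* The ring R with the pi-adic topology. *)
Definition adic (R : idomainType) (pi : R) : Type := R.

Section Adic.
Variables (R : idomainType) (pi : R).
Local Notation T := (adic pi).

HB.instance Definition _ := GRing.IntegralDomain.copy T R.
HB.instance Definition _ := isPointed.Build T 0.

Definition adic_ideal n : set T := range (fun z : T => (pi : T) ^+ n * z).

Let adic_ideal0 n : adic_ideal n 0. Proof. by exists 0; rewrite // mulr0. Qed.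

Let adic_idealB n x y : adic_ideal n x -> adic_ideal n y -> adic_ideal n (x - y).
Proof. by move=> [a _ <-] [b _ <-]; exists (a - b); rewrite // mulrBr. Qed.

Let adic_ideal_decr m n : (m <= n)%N -> adic_ideal n `<=` adic_ideal m.
Proof.
move=> lemn x [a _ <-]; exists ((pi : T) ^+ (n - m) * a) => //.
by rewrite mulrA -exprD subnKC.
Qed.

HB.instance Definition _ := isUniform.Build T
  (chain_entourage_filter adic_ideal_decr)
  (chain_entourage_diagonal adic_ideal0)
  (chain_entourage_inv adic_ideal0 adic_idealB)
  (chain_entourage_split adic_ideal0 adic_idealB).

Definition adic_ball n (x : T) : set T := [set y | adic_ideal n (y - x)].

Lemma nbhs_adicP (x : T) (A : set T) :
  nbhs x A <-> exists n, adic_ball n x `<=` A.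
Proof.
rewrite -nbhs_entourageE; split.
  move=> [B [n _ nB] BA]; exists n => y Iyx; apply: BA.
  by apply/mem_set/nB.
move=> [n nA]; exists [set xy | adic_ideal n (xy.2 - xy.1)]; first by exists n.
by move=> y /set_mem /= Iyx; apply: nA.
Qed.

End Adic.

(* A measure on T is a finitely additive function on the compact open subsets *)
(* of T; it is represented by a function on all subsets, whose values on the  *)
(* other ones are irrelevant.                                                 *)
Definition is_measure (T : topologicalType) (M : zmodType) (mu : set T -> M) :
    Prop :=
  forall U V : set T, open U -> compact U -> open V -> compact V ->
    U `&` V = set0 -> mu (U `|` V) = mu U + mu V.

Definition dirac_measure (T : Type) (R : pzRingType) (x : T) : set T -> R :=
  fun U => \1_U x.
Arguments dirac_measure {T R} x.

Lemma is_measure_dirac (T : topologicalType) (R : pzRingType) (x : T) :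
  is_measure (@dirac_measure T R x).
Proof.
move=> U V _ _ _ _ UV0; rewrite /dirac_measure !indicE in_setU.
have : ~ ((x \in U) /\ (x \in V)).
  by move=> [/set_mem xU /set_mem xV]; have : (U `&` V) x by []; rewrite UV0.
by case: (x \in U); case: (x \in V) => // H; rewrite ?addr0 ?add0r //; case: H.
Qed.

Section Completion.
Variables (k : finFieldType) (v : {poly k}).
Variables (Av : idomainType) (iota : {rmorphism {poly k} -> Av}).

Local Notation T := (adic (iota v)).
Local Notation Kv := {fraction T}.
Local Notation "x %:F" := (@FracField.tofrac T x).

(* iota exhibits Av, with the topology of the powers of the ideal generated   *)
(* by iota v, as the completion of k[theta] for the v-adic topology.          *)
Record is_completion : Prop := IsCompletion {
  completion_induced : forall n (a : {poly k}),
    @adic_ideal Av (iota v) n (iota a) <-> (v ^+ n %| a)%R;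
  completion_dense : dense (range (iota : {poly k} -> T));
  completion_hausdorff : hausdorff_space T;
  completion_complete : forall G : set_system T,
    ProperFilter G -> cauchy G -> cvg G }.

Definition iotaF (a : {poly k}) : Kv := (iota a : T)%:F.

(* {poly_t k} is the finite type of polynomials of degree < t, 0 included;    *)
(* in particular carlitz_e 0 = 'X.                                            *)
Definition carlitz_e t : {poly {poly k}} :=
  \prod_(a : {poly_t k}) ('X - (a : {poly k})%:P).

Definition carlitz_D t : {poly k} :=
  \prod_(a : {poly_t.+1 k} | (size a == t.+1) && ((a : {poly k}) \is monic))
    (a : {poly k}).

Definition carlitz_seq t : {poly Kv} :=
  (iotaF (carlitz_D t))^-1 *: map_poly iotaF (carlitz_e t).

(* G_i, over the fraction field of Av. *)
Definition carlitz_poly i : {poly Kv} := pE #|k| carlitz_seq i.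

(* The map x |-> G_i(x) from Av to itself: tofrac is injective and G_i(x)     *)
(* lies in Av, so that y exists and is unique.                                *)
Definition carlitz_fun i (x : T) : T :=
  get [set y : T | y%:F = (carlitz_poly i).[x%:F]].

(* The polynomials of degree < n * deg v represent Av / v ^ n. *)
Definition riemann_sum (mu : set T -> T) (f : T -> T) n : T :=
  \sum_(a : {poly_(n * (size v).-1) k})
    f (iota a) * mu (adic_ball n (iota a : T)).

Definition adic_integral (mu : set T -> T) (f : T -> T) : T :=
  lim (riemann_sum mu f @ \oo).

(* (mu * nu)(U) = \int mu (U - y) d nu(y) *)
Definition convolution (mu nu : set T -> T) : set T -> T :=
  fun U => adic_integral nu (fun y => mu [set x | U (x + y)]).

Definition partial_convolution (mu : nat -> set T -> T) n : set T -> T :=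
  \big[convolution/dirac_measure 0]_(t < n) mu t.

(* The image \sum_i (\int G_i d mu) D_i in Av{{D}} of the measure mu. *)
Definition measure_series (mu : set T -> T) : dpseries T :=
  fun i => adic_integral mu (carlitz_fun i).

Hypothesis v_neq0 : v != 0.
Hypothesis completion_v : is_completion.

Lemma riemann_sum_dirac (x : T) (f : T -> T) n : exists2 b : {poly k},
  adic_ball n x (iota b) & riemann_sum (dirac_measure x) f n = f (iota b).
Proof.
have vn0 : v ^+ n != 0 by rewrite expf_neq0.
have svn : size (v ^+ n) = (n * (size v).-1).+1.
  by rewrite -[LHS]prednK ?size_poly_gt0 // size_exp mulnC.
have vnE : iota v ^+ n = iota (v ^+ n) by rewrite rmorphXn.
have [y [xy [a _ ay]]] : adic_ball n x `&` range (iota : {poly k} -> T) !=set0.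
  apply: (completion_dense completion_v).
    by exists x; exists 0; rewrite // mulr0 subrr.
  rewrite openE => y [z _ yx]; apply/nbhs_adicP; exists n => w [z' _ wy].
  by exists (z + z') => //; rewrite mulrDr yx wy addrC addrA subrK.
have sb : (size (a %% v ^+ n)%R <= n * (size v).-1)%N.
  by rewrite -ltnS -svn ltn_modp.
have xb : adic_ball n x (iota (a %% v ^+ n)%R).
  move: xy => [z _ yx]; exists (z - iota (a %/ v ^+ n)%R) => //.
  rewrite mulrBr yx -ay [in iota a](divp_eq a (v ^+ n)) rmorphD rmorphM /= -vnE.
  by rewrite [iota (a %/ _)%R * _]mulrC [_ + iota _]addrC addrAC addrK.
exists (a %% v ^+ n)%R => //; rewrite /riemann_sum.
rewrite (bigD1 (npolyp _ (a %% v ^+ n)%R)) //= npolypK // big1 => [|c ca].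
  rewrite addr0 /dirac_measure indicE mem_set ?mulr1 //.
  have [z _ Ez] := xb; exists (- z) => //.
  by rewrite mulrN Ez opprB.
rewrite /dirac_measure indicE memNset ?mulr0 // => xc; case/negP: ca.
have : (v ^+ n %| (c : {poly k}) - (a %% v ^+ n))%R.
  apply/(completion_induced completion_v); rewrite rmorphB /=.
  have [z _ Ez] := xb; have [z' _ Ez'] := xc; exists (- z - z') => //.
  by rewrite mulrBr mulrN Ez Ez' !opprB addrC addrA subrK.
move=> dvd; apply/eqP/val_inj; apply/eqP; rewrite /= npolypK // -subr_eq0.
apply/negPn/negP => nz; have := dvdp_leq nz dvd.
rewrite svn leqNgt ltnS (leq_trans (size_polyD _ _)) // geq_max size_polyN.
by rewrite sb size_npoly.
Qed.

Lemma adic_integral_dirac (x : T) (f : T -> T) :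
  continuous f -> adic_integral (dirac_measure x) f = f x.
Proof.
move=> fc; apply: cvg_lim; first exact: (completion_hausdorff completion_v).
move=> A /(fc x) /nbhs_adicP [n nA]; exists n => // m /= lenm.
have [b xb ->] := riemann_sum_dirac x f m; apply: nA.
have [z _ Ez] := xb; exists ((iota v) ^+ (m - n) * z) => //.
by rewrite mulrA -exprD subnKC.
Qed.

End Completion.

Arguments BD q {F}.
Arguments BD_single q {F}.

(* Main.v *)
(* By Lucas' theorem the binomial coefficients met when the factors f_t built *)
(* from the single entries e_t are multiplied are all 1, so the product of    *)
(* the first n factors is f_(P_E) truncated at q^n.                           *)
(*                                                                            *)
(* For the Dirac measure, the recursion (theta^(q^t) - theta) E_t =           *)
(* E_(t-1)^q - E_(t-1) for E_t = e_t / D_t makes E_t integral, hence          *)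
(* continuous, on A_v.  The series of delta_a for deg a < n span D_i, i < q^n *)
(* (Vandermonde over F_q, and delta_(c theta^n) is the n-th factor times an   *)
(* invertible product of earlier ones), so each factor is the series of a     *)
(* finite combination of Dirac measures at points of A.  Inverting the same   *)
(* square matrix (G_i(a)) solves interpolation at deg a < n; since E_t mod v  *)
(* is periodic modulo v^N for t < N deg v, the interpolant of a continuous    *)
(* function f approximates f modulo v everywhere, and iterating, the G_i span *)
(* a dense subspace.  This gives the convergence of the infinite convolution. *)

Require Import Defs.
From HB Require Import structures.
From mathcomp Require Import all_boot all_order all_algebra all_field.
From mathcomp Require Import all_classical all_reals all_analysis.
From mathcomp Require Import zify ring.

Set Implicit Arguments.
Unset Strict Implicit.
Unset Printing Implicit Defensive.

Import GRing.Theory.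

Local Open Scope classical_set_scope.
Local Open Scope ring_scope.

(** A sequence with the single entry [E t] yields the series of all E_t^l D_(l q^t) with l < q. In
    characteristic p, Lucas' theorem gives D_i D_j = D_(i+j) as soon as i < q^n and q^n divides j,
    so multiplying the first n of these series reassembles the q-adic digits: the result is the
    series of [E] cut off at index q^n ([prod_digit_prod_only]), and the cut-offs converge.

    The Dirac measure is the same computation with the values E_t(alpha) of the Carlitz functions,
    which lie in A_v ([carlitz_integral]). The t-th factor has coefficient E_t(alpha) at q^t; the
    roots of E_t are polynomials, so no factor is 1 when alpha is outside A
    ([digit_prod_only_neq1]).

    For convolutions, each factor has finitely many nonzero coefficients, and every such series
    comes from a finite combination of Dirac measures at polynomials ([spanned_finite]). Convolving
    these combinations multiplies series, because additivity of E_t makes the series of delta_(x+y)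
    the product of those of delta_x and delta_y ([GammaD]). Against a fixed G_i, the integrals of
    the partial convolutions are eventually constant; as the G_i span a uniformly dense space
    ([gcomb_approx]) and all weights lie in A_v, the integrals of every continuous function converge
    ([dint_weak_cvg]). *)

(** * Lucas' theorem for powers of p *)

Lemma exprDn_pexp (R : comNzRingType) p l : prime p -> p%:R = 0 :> R ->
  {morph (fun x : R => x ^+ (p ^ l)%N) : x y / x + y}.
Proof.
move=> pp pR x y; apply: exprDn_pchar.
have ch : p \in [pchar R] by rewrite inE pp pR eqxx.
apply/pnatP; first by rewrite expn_gt0 prime_gt0.
move=> r pr; case: l => [|l]; first by rewrite dvdn1 => /eqP r1;
  rewrite r1 in pr.
by rewrite Euclid_dvdX // dvdn_prime2 // => /andP [/eqP -> _].
Qed.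

(** Compare coefficients in (X + 1)^(n + Q) = (X + 1)^n (X^Q + 1) over F_p, where Q = p^l. *)
Lemma bin_addn_pexp p l n k : prime p ->
  'C(n + p ^ l, k) =
    'C(n, k) + (if (p ^ l <= k)%N then 'C(n, k - p ^ l) else 0) %[mod p].
Proof.
move=> pp; set Q := (p ^ l)%N.
have ch : p \in [pchar {poly 'F_p}] by rewrite pchar_poly pchar_Fp.
have coefB m j : (('X + 1 : {poly 'F_p}) ^+ m)`_j = 'C(m, j)%:R.
  rewrite exprD1n coef_sum.
  under eq_bigr do rewrite coefMn coefXn.
  case: (ltnP j m.+1) => jm; last first.
    rewrite bin_small // big1 // => i _.
    by rewrite gtn_eqF ?mul0rn // (leq_trans (ltn_ord i)).
  rewrite (bigD1 (Ordinal jm)) //= eqxx big1 ?addr0 // => i.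
  by rewrite -val_eqE eq_sym /= => /negbTE ->; rewrite mul0rn.
have : (('X + 1 : {poly 'F_p}) ^+ (n + Q))`_k =
   (('X + 1 : {poly 'F_p}) ^+ n * ('X^Q + 1))`_k.
  by rewrite exprD [X in _ * X](exprDn_pexp l pp (pcharf0 ch)) expr1n.
rewrite mulrDr mulr1 coefD coefMXn !coefB ltnNge => E.
have {E} : (('C(n + Q, k))%:R : 'F_p) =
    ('C(n, k) + (if (Q <= k)%N then 'C(n, k - Q) else 0))%:R.
  by rewrite E natrD addrC; case: leqP => /= _.
by move/(congr1 (fun x : 'F_p => x : nat)); rewrite !val_Fp_nat.
Qed.

(** Induction on [m]: adding p^e to the upper index acts modulo p as Pascal's rule on the leading
    parts. *)
Lemma lucas_pexp p e m r l j : prime p -> (r < p ^ e)%N -> (j < p ^ e)%N ->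
  'C(m * p ^ e + r, l * p ^ e + j) = 'C(m, l) * 'C(r, j) %[mod p].
Proof.
move=> pp ltr ltj; elim: m l => [|m IH] l.
  case: l => [|l]; first by rewrite bin0 mul1n.
  rewrite (bin_small (_ : (0 < l.+1)%N)) // bin_small //.
  by rewrite mulSn; lia.
have -> : (m.+1 * p ^ e + r = m * p ^ e + r + p ^ e)%N by rewrite mulSn; lia.
rewrite bin_addn_pexp //.
case: l => [|l].
  rewrite mul0n add0n leqNgt ltj addn0 -[j in LHS]add0n -(mul0n (p ^ e)%N) IH.
  by rewrite !bin0.
have -> : (p ^ e <= l.+1 * p ^ e + j)%N by rewrite mulSn; lia.
have -> : (l.+1 * p ^ e + j - p ^ e = l * p ^ e + j)%N by rewrite mulSn; lia.
by rewrite -modnDm !IH modnDm binS mulnDl addnC.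
Qed.

(** * Products over the digits *)

Section DigitProduct.
Variables (R : comPzRingType) (p lam : nat).
Hypotheses (p_prime : prime p) (lam_gt0 : (0 < lam)%N) (pR : p%:R = 0 :> R).
Local Notation q := (p ^ lam)%N.
Implicit Types (E : nat -> R) (f g : dpseries R).

(** This is [fPE] over an arbitrary ring, so that one theory serves both polynomials and their
    values in A_v. *)
Definition digit_prod b E : dpseries R :=
  fun i => \prod_(t < i.+1) E t ^+ ((i %/ b ^ t) %% b)%N.
Local Notation dprod := (digit_prod q).

Lemma pexp_gt1 : (1 < q)%N.
Proof. by rewrite -(exp1n lam) ltn_exp2r // prime_gt1. Qed.
Let q_gt1 := pexp_gt1.
Let q_gt0 : (0 < q)%N := ltnW q_gt1.
Let qX_gt0 t : (0 < q ^ t)%N. Proof. by rewrite expn_gt0 q_gt0. Qed.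

Lemma mulrn_modp (x : R) m n : m = n %[mod p] -> x *+ m = x *+ n.
Proof.
have px k : x *+ (k * p) = 0.
  by rewrite mulnC mulrnA -[x *+ p]mulr_natr pR mulr0 mul0rn.
by move=> E; rewrite (divn_eq m p) (divn_eq n p) E !mulrnDr !px.
Qed.

Lemma dpME f g i : (f * g) i = \sum_(j < i.+1) (f j * g (i - j)%N) *+ 'C(i, j).
Proof. by []. Qed.
Lemma dp1E i : (1 : dpseries R) i = (i == 0%N)%:R. Proof. by []. Qed.
Lemma dp_sumE (I : Type) (s : seq I) (P : pred I) (F : I -> dpseries R) i :
  (\sum_(x <- s | P x) F x) i = \sum_(x <- s | P x) F x i.
Proof. by apply: (big_morph (fun f : dpseries R => f i)). Qed.

(** The digits of [i] from position [n] on vanish, so any sufficient number of factors gives the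
    same product. *)
Lemma digit_prod_widen E i n : (i < q ^ n)%N ->
  dprod E i = \prod_(t < n) E t ^+ ((i %/ q ^ t) %% q)%N.
Proof.
pose F t := E t ^+ ((i %/ q ^ t) %% q)%N.
have wid a b : (a <= b)%N -> (i < q ^ a)%N ->
    \prod_(t < b) F t = \prod_(t < a) F t.
  move=> ab ia; rewrite -!(big_mkord xpredT F) (big_cat_nat (n := a)) //=.
  rewrite [X in _ * X]big_nat_cond [X in _ * X]big1 ?mulr1 // => t.
  rewrite andbT => /andP [at_ _]; rewrite /F divn_small ?mod0n //.
  by apply: leq_trans ia _; rewrite leq_exp2l.
move=> iq; rewrite /digit_prod.
have iq' : (i < q ^ i.+1)%N by apply: ltn_trans (ltn_expl _ q_gt1) _;
  rewrite ltn_exp2l.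
by case: (leqP n i.+1) => [le|/ltnW le]; [apply: wid|symmetry; apply: wid].
Qed.

Lemma digit_prod_rec E m r : (r < q)%N ->
  dprod E (m * q + r) = E 0%N ^+ r * dprod (E \o S) m.
Proof.
move=> rq; rewrite {1}/digit_prod big_ord_recl /=; congr (_ * _).
  by rewrite expn0 divn1 modnMDl modn_small.
rewrite (@digit_prod_widen _ m (m * q + r)); last first.
  apply: leq_ltn_trans (ltn_expl _ q_gt1).
  by apply: leq_trans (leq_addr _ _); rewrite leq_pmulr.
apply: eq_bigr => t _; rewrite /= /bump /= add1n expnS divnMA.
by rewrite divnMDl // [(r %/ q)%N]divn_small // addn0.
Qed.

Lemma digit_prod0 i : dprod (fun _ => 0) i = (i == 0%N)%:R.
Proof.
elim/ltn_ind: i => i IH; case: (posnP i) => [->|i0].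
  by rewrite /digit_prod big_ord1 div0n mod0n expr0.
rewrite {1}(divn_eq i q) digit_prod_rec ?ltn_mod // -/(fun _ => 0) IH ?ltn_Pdiv
  //.
rewrite expr0n /=.
case: (eqVneq (i %% q)%N 0%N) => [r0|_]; last by rewrite mul0r.
case: (eqVneq (i %/ q)%N 0%N) => [d0|_]; last by rewrite mulr0.
by move: i0; rewrite (divn_eq i q) r0 d0.
Qed.

Lemma digit_prod_only E t i : dprod (only E t) i =
  if (q ^ t %| i)%N && (i < q ^ t.+1)%N then E t ^+ (i %/ q ^ t)%N else 0.
Proof.
elim: t E i => [|t IH] E i; rewrite {1}(divn_eq i q) digit_prod_rec ?ltn_mod //.
  rewrite /only /= [X in _ * X](_ : _ = ((i %/ q)%N == 0%N)%:R);
    last exact: digit_prod0.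
  rewrite expn0 dvd1n expn1 divn1 /= -leqn0 -[(_ <= 0)%N]ltnS ltn_divLR //
    mul1n.
  by case: ltnP => h; rewrite ?mulr1 ?mulr0 // modn_small.
rewrite [X in _ * X](_ : _ = dprod (only (E \o S) t) (i %/ q)%N) //.
rewrite IH {1}/only /= expr0n.
case: (posnP (i %% q)%N) => r0; last first.
  rewrite mul0r; case: ifP => // /andP [d _].
  have : (q %| i)%N by apply: dvdn_trans d; rewrite expnS dvdn_mulr.
  by rewrite /dvdn gtn_eqF.
have -> : (i %/ q ^ t.+1 = i %/ q %/ q ^ t)%N by rewrite expnS divnMA.
rewrite mul1r dvdn_divRL; last by rewrite /dvdn r0.
by rewrite ltn_divLR // -!expnSr.
Qed.

Lemma digit_prod_topE E n i : (i < q ^ n.+1)%N ->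
  dprod E i = dprod E (i %% q ^ n)%N * E n ^+ (i %/ q ^ n).
Proof.
move=> iq; rewrite (digit_prod_widen _ iq) big_ord_recr /=.
rewrite [(i %/ q ^ n %% q)%N]modn_small ?ltn_divLR -?expnS //.
rewrite (@digit_prod_widen _ (i %% q ^ n)%N n) ?ltn_mod //.
congr (_ * _); apply: eq_bigr => t _; congr (_ ^+ _).
case: t => t /= tn; rewrite [in LHS](divn_eq i (q ^ n)).
have -> : (q ^ n = q ^ (n - t).-1 * q * q ^ t)%N.
  by rewrite -expnSr -expnD prednK ?subn_gt0 // subnK // ltnW.
by rewrite mulnA divnMDl // mulnA modnMDl.
Qed.

(* By Lucas' theorem, no carry occurs and the binomial coefficient is 1. *)
Lemma dpmul_disjoint n f g i :
  (forall j, (q ^ n <= j)%N -> f j = 0) ->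
  (forall j, ~~ (q ^ n %| j)%N -> g j = 0) ->
  (f * g) i = f (i %% q ^ n)%N * g (i %/ q ^ n * q ^ n)%N.
Proof.
move=> f0 g0; set Q := (q ^ n)%N.
have Q_gt0 : (0 < Q)%N by exact: qX_gt0.
have ri : (i %% Q < i.+1)%N by rewrite ltnS leq_mod.
rewrite dpME (bigD1 (Ordinal ri)) //= big1 ?addr0.
  have -> : (i - i %% Q = i %/ Q * Q)%N by rewrite {1}(divn_eq i Q) addnK.
  rewrite -[RHS]mulr1n; apply: mulrn_modp.
  rewrite {1}(divn_eq i Q) -[X in 'C(_, X)]add0n -(mul0n Q).
  have QE : Q = (p ^ (lam * n))%N by rewrite expnM.
  by rewrite QE lucas_pexp // -?QE ?ltn_mod // bin0 binn.
(* A surviving index has [j < Q] and [Q] dividing [i - j], which forces [j] to be the residue of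
   [i]. *)
move=> j /eqP jE; case: (leqP Q j) => [Qj|jQ];
  first by rewrite f0 // mul0r mul0rn.
rewrite [g _]g0 ?mulr0 ?mul0rn //; apply/negP => dv.
have ji : (j <= i)%N by rewrite -ltnS.
apply: jE; apply/val_inj => /=; have := modnDml (i - j) j Q.
by rewrite (eqP dv) add0n subnK // => <-; rewrite modn_small.
Qed.

(** The first [n] factors live below q^n and the next one on multiples of q^n, so [dpmul_disjoint]
    appends one top digit at a time. *)
Lemma prod_digit_prod_only E n i :
  (\prod_(t < n) dprod (only E t)) i = if (i < q ^ n)%N then dprod E i else 0.
Proof.
elim: n i => [|n IH] i.
  rewrite big_ord0 dp1E expn0 ltnS leqn0; case: eqP => [->|//].
  by rewrite /digit_prod big_ord1 div0n mod0n.
rewrite big_ord_recr /= (@dpmul_disjoint n).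
- rewrite IH ltn_mod qX_gt0 digit_prod_only dvdn_mull //= mulnK //.
  have -> : (i %/ q ^ n * q ^ n < q ^ n.+1)%N = (i < q ^ n.+1)%N.
    by rewrite expnS ltn_pmul2r // ltn_divLR.
  by case: ltnP => h; rewrite ?mulr0 // [RHS](digit_prod_topE _ h).
- by move=> j; rewrite IH ltnNge => ->.
- by move=> j; rewrite digit_prod_only => /negbTE ->.
Qed.

(** An exponential law. Strong induction on the index: expand the lowest digit by the binomial
    theorem, use the induction hypothesis on the remaining digits, and recombine the two binomial
    coefficients by Lucas. *)
Lemma digit_prodD E E' :
  dprod (fun t => E t + E' t) = dprod E * dprod E'.
Proof.
apply/funext => i; elim/ltn_ind: i E E' => i IH E E'.
case: (posnP i) => [->|i0].
  by rewrite dpME big_ord1 bin0 /digit_prod !big_ord1 div0n mod0n !expr0 mulr1.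
set m := (i %/ q)%N; set r := (i %% q)%N.
have iE : i = (m * q + r)%N by exact: divn_eq.
have rq : (r < q)%N by rewrite ltn_mod.
have mi : (m < i)%N by rewrite ltn_Pdiv.
rewrite {1}iE digit_prod_rec // -/(fun t => (E \o S) t + (E' \o S) t).
rewrite [dprod _ m](IH m mi (E \o S) (E' \o S)).
rewrite addrC exprDn !dpME mulr_suml.
pose F j := (dprod E j * dprod E' (i - j)%N) *+ 'C(i, j).
(* The range is extended to full blocks of length [q] so that indices split as quotient and
   remainder; the added binomial coefficients are zero. *)
transitivity (\sum_(0 <= j < m.+1 * q) F j); last first.
  rewrite (big_cat_nat (n := i.+1)) //=; last first.
    by rewrite {1}iE mulSn addnC; lia.
  rewrite big_mkord [X in _ + X]big_nat_cond [X in _ + X]big1 ?addr0 // => j.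
  by rewrite andbT => /andP [ij _]; rewrite /F bin_small.
rewrite big_nat_mul big_mkord.
transitivity (\sum_(j < q) \sum_(l < m.+1)
   (E' 0%N ^+ (r - j) * E 0%N ^+ j *+ 'C(r, j)) *
   (dprod (E \o S) l * dprod (E' \o S) (m - l)%N *+ 'C(m, l))).
  transitivity (\sum_(j < r.+1) \sum_(l < m.+1)
   (E' 0%N ^+ (r - j) * E 0%N ^+ j *+ 'C(r, j)) *
   (dprod (E \o S) l * dprod (E' \o S) (m - l)%N *+ 'C(m, l))).
    by apply: eq_bigr => j _; rewrite mulr_sumr.
  rewrite (big_ord_widen q (fun j => \sum_(l < m.+1)
   (E' 0%N ^+ (r - j) * E 0%N ^+ j *+ 'C(r, j)) *
   (dprod (E \o S) l * dprod (E' \o S) (m - l)%N *+ 'C(m, l)))) //.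
  rewrite [LHS]big_mkcond; apply: eq_bigr => j _; case: ltnP => // rj.
  by rewrite big1 // => l _; rewrite bin_small // mulr0n mul0r.
rewrite exchange_big; apply: eq_bigr => l _ /=.
rewrite -{1}(add0n (l * q)%N) big_addn mulSn addnK big_mkord;
  apply: eq_bigr => j _.
have lm : (l <= m)%N by rewrite -ltnS.
rewrite /F [(j + _)%N]addnC [in 'C(i, _)]iE.
rewrite (mulrn_modp _ (lucas_pexp m l p_prime rq (ltn_ord j))).
case: (leqP j r) => jr; last by rewrite (bin_small jr) muln0 !mulr0n mul0r.
have -> : (i - (l * q + j) = (m - l) * q + (r - j))%N.
  have lmq : (l * q <= m * q)%N by rewrite leq_mul2r lm orbT.
  by rewrite iE mulnBl; lia.
rewrite !digit_prod_rec //; last by apply: leq_ltn_trans rq; apply: leq_subr.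
rewrite mulnC mulrnA mulrnAr mulrnAl; congr (_ *+ _ *+ _).
by rewrite [E' 0%N ^+ _ * _]mulrC mulrACA.
Qed.

Lemma prod_digit_prod_cvg E :
  (fun n => \prod_(t < n) dprod (only E t)) @ \oo --> dprod E.
Proof.
move=> A /nbhs_dpseriesP [n nA]; exists n => // N /= nN; apply: nA => i iin.
rewrite -[LHS]/((\prod_(t < N) dprod (only E t)) i - dprod E i).
rewrite prod_digit_prod_only ifT ?subrr //.
exact: ltn_trans (leq_trans iin nN) (ltn_expl _ q_gt1).
Qed.

End DigitProduct.

(** * The Carlitz linear polynomials *)

Section Carlitz.
Variables (k : finFieldType) (K : fieldType) (h : {rmorphism {poly k} -> K}).
Hypothesis h_inj : injective h.
Variables (p lam : nat).
Hypotheses (p_prime : prime p) (lam_gt0 : (0 < lam)%N) (card_k : #|k| = (p ^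
  lam)%N).
Local Notation q := (p ^ lam)%N.
Local Notation theta := (h 'X).

Let q_gt1 : (1 < q)%N := pexp_gt1 p_prime lam_gt0.
Let q_gt0 : (0 < q)%N := ltnW q_gt1.

Lemma pchar_ext (R : nzRingType) (j : {rmorphism k -> R}) : p%:R = 0 :> R.
Proof.
have /pcharf0 pk := card_finPcharP card_k p_prime.
by rewrite -(rmorph_nat j) pk rmorph0.
Qed.

Let pK : p%:R = 0 :> K. Proof. exact: (pchar_ext (h \o polyC)). Qed.
Let frobD : {morph (fun x : K => x ^+ q) : x y / x + y} := exprDn_pexp lam
  p_prime pK.
Let frobB : {morph (fun x : K => x ^+ q) : x y / x - y}.
Proof.
move=> x y; apply: (addIr (y ^+ q)).
by rewrite -[LHS]/((x - y) ^+ q + y ^+ q) -frobD !subrK.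
Qed.

Lemma frob_const c : (h c%:P) ^+ q = h c%:P.
Proof. by rewrite -rmorphXn -polyC_exp -card_k expf_card. Qed.

(* Carlitz's [t]. *)
Definition bracket t : K := theta ^+ (q ^ t) - theta.

Lemma bracket_neq0 t : bracket t.+1 != 0.
Proof.
have -> : bracket t.+1 = h ('X^(q ^ t.+1) - 'X) by rewrite rmorphB rmorphXn.
rewrite -(rmorph0 h) (inj_eq h_inj) -size_poly_eq0 size_polyDl ?size_polyXn //.
by rewrite size_polyN size_polyX ltnS -[X in (X < _)%N](expn0 q) ltn_exp2l.
Qed.

(* Carlitz's recursion for e_t / D_t (see cL_carlitz); linearity, vanishing   *)
(* and integrality on k[theta] are read off it more easily than off the       *)
(* product defining e_t.                                                      *)
Fixpoint cL t : {poly K} :=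
  if t is s.+1 then (bracket t)^-1 *: (cL s ^+ q - cL s) else 'X.

(** The q-th power raises each coefficient to the power q and shifts it by one index. *)
Lemma cL_expand t : exists c : nat -> K, cL t = \sum_(i < t.+1) c i *: 'X^(q ^
  i).
Proof.
elim: t => [|t [c IH]]; first by exists (fun _ => 1); rewrite big_ord1 scale1r.
exists (fun i => (bracket t.+1)^-1 *
  ((if i is j.+1 then c j ^+ q else 0) - (if (i < t.+1)%N then c i else 0))).
have pP : p%:R = 0 :> {poly K} by rewrite -polyC_natr pK.
have frobS (I : Type) (s : seq I) (F : I -> {poly K}) :
    (\sum_(i <- s) F i) ^+ q = \sum_(i <- s) F i ^+ q.
  apply: (big_morph (fun x : {poly K} => x ^+ q)); first exact: exprDn_pexp.
  by rewrite expr0n gtn_eqF.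
rewrite /= IH frobS -/(bracket t.+1).
under [in RHS]eq_bigr do rewrite -scalerA.
rewrite -scaler_sumr; congr (_ *: _).
under [in RHS]eq_bigr do rewrite scalerBl.
rewrite sumrB; congr (_ - _).
  rewrite [RHS]big_ord_recl /= scale0r add0r; apply: eq_bigr => i _.
  by rewrite exprZn -exprM -expnSr.
rewrite [RHS]big_ord_recr /= ltnn scale0r addr0; apply: eq_bigr => i _.
by rewrite ltn_ord.
Qed.

Lemma cL_qlinear t : qlinear q (cL t).
Proof. by have [c ->] := cL_expand t; exists t.+1, c. Qed.

Local Notation l t x := ((cL t).[x]).

Lemma cLS t x : l t.+1 x = (bracket t.+1)^-1 * (l t x ^+ q - l t x).
Proof. by rewrite /= hornerZ hornerD hornerN horner_exp. Qed.

Lemma cLD t x y : l t (x + y) = l t x + l t y.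
Proof.
elim: t => [|t IH]; first by rewrite !hornerX.
rewrite !cLS IH -mulrDr; congr (_ * _).
by rewrite [(_ + _) ^+ q]frobD opprD addrACA.
Qed.

Lemma cLZ t c x : l t (h c%:P * x) = h c%:P * l t x.
Proof.
elim: t => [|t IH]; first by rewrite !hornerX.
by rewrite !cLS IH exprMn frob_const -mulrBr mulrCA.
Qed.

Lemma cL0 t : l t 0 = 0.
Proof. by rewrite -[X in l t X](mul0r 0) -(rmorph0 h) cLZ rmorph0 mul0r. Qed.

(** The convention E_(-1) = 0 makes the recursions below valid at [t = 0]. *)
Definition cLpred t x := if t is s.+1 then l s x else 0.

Lemma cL_bracket t x : bracket t * l t x = cLpred t x ^+ q - cLpred t x.
Proof.
case: t => [|t]; first by rewrite /bracket expn0 expr1 subrr mul0r expr0n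
  gtn_eqF // subr0.
by rewrite cLS mulrA divff ?mul1r ?bracket_neq0.
Qed.

(** This is the coefficient form of C_theta = theta + tau for the Carlitz module, E_t(x) being the
    coefficient of tau^t in C_x. It is checked after multiplication by [bracket t], using the q-th
    power of [cL_bracket]. *)
Lemma cL_theta t x : l t (theta * x) = theta * l t x + cLpred t x ^+ q.
Proof.
elim: t => [|t IH].
  by rewrite !hornerX /= expr0n gtn_eqF ?addr0.
apply: (mulfI (bracket_neq0 t)); rewrite mulrDr mulrCA.
rewrite !cL_bracket /= IH [(_ + _) ^+ q]frobD exprMn.
have : (bracket t * l t x) ^+ q = (cLpred t x ^+ q) ^+ q - cLpred t x ^+ q.
  by rewrite cL_bracket [LHS]frobB.
rewrite exprMn /bracket [(_ - _) ^+ q]frobB -exprM -expnSr.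
set a := theta ^+ _; set b := theta ^+ q; set c := l t x ^+ q.
by move=> /eqP; rewrite eq_sym subr_eq => /eqP ->; ring.
Qed.

Lemma cL1 t : l t.+1 1 = 0.
Proof.
elim: t => [|t IH]; rewrite cLS; first by rewrite !hornerX expr1n subrr mulr0.
by rewrite IH expr0n gtn_eqF // subr0 mulr0.
Qed.

Lemma cL_polyXC t a c :
  l t (h (a * 'X + c%:P)) = theta * l t (h a) + cLpred t (h a) ^+ q + h c%:P *
    l t 1.
Proof. by rewrite rmorphD rmorphM /= mulrC cLD cL_theta -cLZ mulr1. Qed.

(** In particular E_t vanishes on polynomials of degree < t and is 1 at theta^t, the two facts that
    identify it with e_t / D_t. *)
Lemma cL_lead t (a : {poly k}) : (size a <= t.+1)%N -> l t (h a) = h (a`_t)%:P.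
Proof.
elim/poly_ind: a t => [|a c IH] t sa; first by rewrite rmorph0 cL0 coef0
  rmorph0.
case: t sa => [|t] sa.
  by rewrite hornerX {1}(size1_polyC sa).
have sa' : (size a <= t.+1)%N.
  move: sa; rewrite size_MXaddC; case: ifP => [/andP [/eqP -> _]|_ //].
  by rewrite size_poly0.
rewrite cL_polyXC cL1 mulr0 addr0 IH ?(leq_trans sa') // nth_default //.
rewrite polyC0 rmorph0 mulr0 add0r /= IH // frob_const coefD coefMX coefC /=.
by rewrite addr0.
Qed.

Lemma cL_int t (a : {poly k}) : exists b, l t (h a) = h b.
Proof.
elim: t a => [|t IHt] a; first by exists a; rewrite hornerX.
elim/poly_ind: a => [|a c [b IH]]; first by exists 0; rewrite rmorph0 cL0.
have [b' IH'] := IHt a.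
exists ('X * b + b' ^+ q).
by rewrite cL_polyXC cL1 mulr0 addr0 IH /= IH' rmorphD rmorphM rmorphXn.
Qed.

Lemma size_cL t : size (cL t) = (q ^ t).+1.
Proof.
elim: t => [|t IH]; first by rewrite size_polyX.
rewrite /= size_scale ?invr_neq0 ?bracket_neq0 // size_polyDl ?size_polyN.
  rewrite -[LHS]prednK; last by rewrite size_poly_gt0 expf_neq0 //
    -size_poly_gt0 IH.
  by rewrite size_exp IH /= -expnSr.
rewrite -[X in (_ < X)%N]prednK; last by rewrite size_poly_gt0 expf_neq0 //
  -size_poly_gt0 IH.
by rewrite size_exp IH /= ltnS -expnSr ltn_exp2l.
Qed.

Lemma map_carlitz_e t : map_poly h (carlitz_e k t) =
  \prod_(r <- [seq h (a : {poly k}) | a : {poly_t k}]) ('X - r%:P).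
Proof.
rewrite big_image rmorph_prod; apply: eq_bigr => a _.
by rewrite /= rmorphB /= map_polyX map_polyC.
Qed.

(** The monic polynomials of degree t are the theta^t - b with deg b < t. *)
Lemma carlitz_D_horner t : carlitz_D k t = (carlitz_e k t).['X^t].
Proof.
rewrite horner_prod /carlitz_D.
have sX (b : {poly k}) : (size b <= t)%N -> size ('X^t - b) = t.+1.
  by move=> sb; rewrite size_polyDl size_polyXn ?size_polyN.
have mX (b : {poly k}) : (size b <= t)%N -> 'X^t - b \is monic.
  move=> sb; rewrite monicE lead_coefDl ?lead_coefXn //.
  by rewrite size_polyN size_polyXn ltnS.
pose u (b : {poly_t k}) := npolyp t.+1 ('X^t - (b : {poly k})).
pose w (a : {poly_t.+1 k}) := npolyp t ('X^t - (a : {poly k})).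
have uE b : u b = 'X^t - (b : {poly k}) :> {poly k}.
  by rewrite npolypK // sX.
have wE (a : {poly_t.+1 k}) : size a = t.+1 -> (a : {poly k}) \is monic ->
    w a = 'X^t - (a : {poly k}) :> {poly k}.
  move=> sa ma; rewrite npolypK //; apply/leq_sizeP => j; rewrite leq_eqVlt.
  rewrite coefB coefXn; case/predU1P => [<-|tj].
    by rewrite eqxx; move: ma; rewrite monicE /lead_coef sa /= => /eqP ->;
      rewrite subrr.
  by rewrite gtn_eqF // sub0r nth_default ?oppr0 // sa.
rewrite (reindex_onto u w) /=; last first.
  move=> a /andP [/eqP sa ma]; apply/val_inj => /=.
  by rewrite [LHS]uE wE // opprB addrC subrK.
apply: eq_big => [b|b _]; last by rewrite uE hornerD hornerX hornerN hornerC.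
have sb := size_npoly b.
have sub : size (u b) = t.+1 by rewrite uE sX.
have mub : (u b : {poly k}) \is monic by rewrite uE mX.
apply/andP; split; first by apply/andP; split; [apply/eqP | ].
by apply/eqP/val_inj; rewrite /= wE // uE opprB addrC subrK.
Qed.

Lemma map_carlitz_D t : h (carlitz_D k t) = (map_poly h (carlitz_e k t)).[theta
  ^+ t].
Proof. by rewrite carlitz_D_horner -rmorphXn horner_map. Qed.

Lemma carlitz_D_neq0 t : carlitz_D k t != 0.
Proof. by apply/prodf_neq0 => a /andP [/eqP sa _];
  rewrite -size_poly_gt0 sa. Qed.

(** [cL t] has degree q^t and vanishes at the q^t polynomials of degree < t, so it is a multiple of
    e_t; evaluation at theta^t gives the scalar. *)
Lemma cL_carlitz t : cL t = (h (carlitz_D k t))^-1 *: map_poly h (carlitz_e k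
  t).
Proof.
set rs := [seq h (a : {poly k}) | a : {poly_t k}].
have : cL t = lead_coef (cL t) *: map_poly h (carlitz_e k t).
  rewrite map_carlitz_e; apply: all_roots_prod_XsubC.
  - by rewrite size_cL size_image card_npoly card_k.
  - apply/allP => r /mapP [a _ ->]; rewrite /root cL_lead ?(leq_trans
    (size_npoly a)) //.
    by rewrite nth_default ?rmorph0 ?size_npoly.
  - rewrite uniq_rootsE map_inj_uniq ?enum_uniq // => a b ab.
    exact/val_inj/h_inj.
move=> E; rewrite [LHS]E; congr (_ *: _).
have DE : lead_coef (cL t) * h (carlitz_D k t) = 1.
  rewrite map_carlitz_D -hornerZ -E -rmorphXn cL_lead ?size_polyXn //.
  by rewrite coefXn eqxx rmorph1.
apply: (mulIf (_ : h (carlitz_D k t) != 0)).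
  by rewrite -(rmorph0 h) (inj_eq h_inj) carlitz_D_neq0.
by rewrite DE mulVf // -(rmorph0 h) (inj_eq h_inj) carlitz_D_neq0.
Qed.

Lemma cL_root t x : root (cL t) x -> exists a, x = h a.
Proof.
rewrite cL_carlitz rootZ ?invr_eq0; last first.
  by rewrite -(rmorph0 h) (inj_eq h_inj) carlitz_D_neq0.
by rewrite map_carlitz_e root_prod_XsubC => /mapP [a _ ->];
  exists (a : {poly k}).
Qed.

End Carlitz.

Lemma irredp_coprimep (F : fieldType) (u a : {poly F}) :
  irreducible_poly u -> ~~ (u %| a) -> coprimep u a.
Proof.
move=> [_ u_irr]; apply: contraNT => ncop.
have /eqp_dvdl <- := u_irr _ ncop (dvdp_gcdl u a).
exact: dvdp_gcdr.
Qed.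

(** * The v-adic completion *)

Section AdicIdeal.
Variables (R : idomainType) (pi : R).
Local Notation T := (adic pi).
Local Notation I := (@adic_ideal R pi).
Implicit Types (x y z : T) (n m : nat).

Lemma ideal_zero n : I n 0. Proof. by exists 0; rewrite // mulr0. Qed.

Lemma ideal_full x : I 0 x. Proof. by exists x; rewrite // expr0 mul1r. Qed.

Lemma ideal_pi n z : I n ((pi : T) ^+ n * z). Proof. by exists z. Qed.

Lemma idealB n x y : I n x -> I n y -> I n (x - y).
Proof. by move=> [a _ <-] [b _ <-]; exists (a - b); rewrite // mulrBr. Qed.

Lemma idealN n x : I n x -> I n (- x).
Proof. by rewrite -sub0r; apply: idealB; apply: ideal_zero. Qed.

Lemma idealNP n x y : I n (x - y) -> I n (y - x).
Proof. by move/idealN; rewrite opprB. Qed.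

Lemma idealD n x y : I n x -> I n y -> I n (x + y).
Proof. by move=> Ix Iy; rewrite -[y]opprK; apply: idealB => //;
  apply: idealN. Qed.

Lemma ideal_trans n x y z : I n (x - y) -> I n (y - z) -> I n (x - z).
Proof. by move=> Ixy Iyz; rewrite -[x](subrK y) -addrA; apply: idealD. Qed.

Lemma idealMr n x y : I n x -> I n (x * y).
Proof. by move=> [a _ <-]; exists (a * y); rewrite // mulrA. Qed.

Lemma idealMl n x y : I n y -> I n (x * y).
Proof. by rewrite mulrC; apply: idealMr. Qed.

Lemma ideal_le m n x : (m <= n)%N -> I n x -> I m x.
Proof.
move=> lemn [a _ <-]; exists ((pi : T) ^+ (n - m) * a) => //.
by rewrite mulrA -exprD subnKC.
Qed.

Lemma ideal_sum (J : Type) (s : seq J) (P : pred J) (F : J -> T) n :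
  (forall j, P j -> I n (F j)) -> I n (\sum_(j <- s | P j) F j).
Proof. by move=> IF; apply: big_ind => //;
  [apply: ideal_zero | apply: idealD]. Qed.

Lemma idealMB n x y x' y' : I n (x - y) -> I n (x' - y') -> I n (x * x' - y *
  y').
Proof.
move=> Ixy Ixy'; have -> : x * x' - y * y' = (x - y) * x' + y * (x' - y') by
  ring.
by apply: idealD; [apply: idealMr | apply: idealMl].
Qed.

Lemma idealXB n x y m : I n (x - y) -> I n (x ^+ m - y ^+ m).
Proof.
move=> Ixy; elim: m => [|m IH]; first by rewrite !expr0 subrr;
  apply: ideal_zero.
by rewrite !exprS; apply: idealMB.
Qed.

Lemma ideal_prodB (J : Type) (s : seq J) (F G : J -> T) n :
  (forall j, I n (F j - G j)) -> I n (\prod_(j <- s) F j - \prod_(j <- s) G j).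
Proof.
move=> IFG; elim: s => [|j s IH]; first by rewrite !big_nil subrr;
  apply: ideal_zero.
by rewrite !big_cons; apply: idealMB.
Qed.

Lemma ideal_cancel n m z : (pi : T) != 0 ->
  I (n + m) ((pi : T) ^+ n * z) -> I m z.
Proof.
move=> pi0 [a _]; rewrite exprD -mulrA => E; exists a => //.
by apply: (mulfI (expf_neq0 n pi0)).
Qed.

(** Uniform continuity, phrased through the ideals. *)
Definition adic_ucont (f : T -> T) : Prop := forall n, exists m, forall x y,
  I m (y - x) -> I n (f y - f x).

Lemma adic_continuousP (f : T -> T) : continuous f <->
  (forall x n, exists m, forall y, I m (y - x) -> I n (f y - f x)).
Proof.
split=> [fc x n|H x A].
  have /(fc x) /nbhs_adicP [m mA] : nbhs (f x) (adic_ball n (f x)).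
    by apply/nbhs_adicP; exists n.
  by exists m => y Iy; apply: (mA y).
case/nbhs_adicP => n nA; have [m mP] := H x n.
by apply/nbhs_adicP; exists m => y /mP Iy; apply: nA.
Qed.

Lemma adic_ucont_continuous f : adic_ucont f -> continuous f.
Proof. by move=> fu; apply/adic_continuousP => x n; have [m mP] := fu n;
  exists m => y; apply: mP. Qed.

End AdicIdeal.

Section Completion.
Variables (p lam : nat) (k : finFieldType) (v : {poly k}).
Variables (Av : idomainType) (iota : {rmorphism {poly k} -> Av}).
Hypotheses (p_prime : prime p) (lam_gt0 : (0 < lam)%N) (card_k : #|k| = (p ^
  lam)%N).
Hypotheses (v_irr : irreducible_poly v) (v_compl : is_completion v iota).
Local Notation q := (p ^ lam)%N.
Local Notation T := (adic (iota v)).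
Local Notation I := (@adic_ideal Av (iota v)).
Local Notation "x %:F" := (@FracField.tofrac T x).
Local Notation d := (size v).-1.
Implicit Types (x y z : T) (a b : {poly k}).

(** Retypes [iota] so that its values carry the topology of [adic (iota v)]. *)
Definition emb : {rmorphism {poly k} -> T} := iota.
Local Notation pi := (emb v).

Lemma v_neq0 : v != 0. Proof. exact: irredp_neq0. Qed.

Lemma size_vX n : size (v ^+ n) = (n * d).+1.
Proof. by rewrite -[LHS]prednK ?size_poly_gt0 ?expf_neq0 ?v_neq0 // size_exp
  mulnC. Qed.

Lemma ideal_emb n a : I n (emb a) <-> v ^+ n %| a.
Proof. exact: (completion_induced v_compl). Qed.

Lemma emb_inj : injective emb.
Proof.
move=> a b /eqP; rewrite -subr_eq0 -rmorphB => /eqP ab0; apply/eqP;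
  rewrite -subr_eq0.
apply/negPn/negP => nz; have : v ^+ (size (a - b)) %| a - b.
  by apply/ideal_emb; rewrite ab0; apply: ideal_zero.
move/(dvdp_leq nz); rewrite size_vX ltnNge => /negP; apply.
by rewrite leq_pmulr // -subn1 subn_gt0; case: v_irr.
Qed.

Lemma pi_neq0 : pi != 0.
Proof. by rewrite -(rmorph0 emb) (inj_eq emb_inj) v_neq0. Qed.

Lemma ideal_separated x : (forall n, I n x) -> x = 0.
Proof.
move=> Ix; apply: (completion_hausdorff v_compl) => A B.
move=> /nbhs_adicP [n nA] /nbhs_adicP [m mB]; exists 0; split.
  by apply: nA; rewrite /adic_ball /= sub0r; apply: idealN.
by apply: mB; rewrite /adic_ball /= subr0; apply: ideal_zero.
Qed.

Lemma emb_dense n x : exists2 a : {poly k}, (size a <= n * d)%N & I n (x - emb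
  a).
Proof.
have [y [xy [a _ ay]]] : adic_ball n x `&` range emb !=set0.
  apply: (completion_dense v_compl).
    by exists x; rewrite /adic_ball /= subrr; apply: ideal_zero.
  rewrite openE => y yx; apply/nbhs_adicP; exists n => w wy.
  exact: ideal_trans wy yx.
exists (a %% v ^+ n); first by rewrite -ltnS -size_vX ltn_modp expf_neq0
  ?v_neq0.
apply: (@ideal_trans _ _ _ _ y); first exact: idealNP.
rewrite -ay -rmorphB; apply/ideal_emb.
by rewrite [X in X - _](divp_eq a (v ^+ n)) addrK dvdp_mull.
Qed.

Lemma ideal_cauchy (u : nat -> T) : (forall n, I n (u n.+1 - u n)) ->
  exists y, forall n, I n (y - u n).
Proof.
move=> cu.
have cu' n m : (n <= m)%N -> I n (u m - u n).
  move/subnK <-; elim: (m - n)%N => [|i IH]; first by rewrite subrr;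
    apply: ideal_zero.
  rewrite addSn; apply: ideal_trans IH.
  by apply: ideal_le (cu _); apply: leq_addl.
have [y uy] : exists y : T, u @ \oo --> y.
  apply/cvg_ex; apply: (completion_complete v_compl) => A [n _ nA].
  exists ([set u m | m in [set m | (n <= m)%N]], [set u m | m in [set m | (n <=
    m)%N]]).
    by split; exists n => // m /= nm; exists m.
  move=> [_ _] [/= [i ni <-] [j nj <-]]; apply: nA => /=.
  by apply: (@ideal_trans _ _ _ _ (u n)); [|apply: idealNP]; apply: cu'.
exists y => n; have : nbhs y (adic_ball n y) by apply/nbhs_adicP; exists n.
case/uy => m _ mP; apply: (@ideal_trans _ _ _ _ (u (maxn m n))).
  by apply: idealNP; apply: (mP (maxn m n)); rewrite /= leq_maxl.
by apply: cu'; apply: leq_maxr.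
Qed.

(** Bezout inverses modulo each v^n are compatible, hence converge to an inverse. *)
Lemma emb_unit a : coprimep v a -> exists w, emb a * w = 1.
Proof.
move=> cva.
have inv n : exists b, v ^+ n %| a * b - 1.
  have /Bezout_eq1_coprimepP [[u w] /= uw] : coprimep (v ^+ n) a by rewrite
    coprimep_expl.
  exists w; rewrite -uw [a * w]mulrC opprD addrCA subrr addr0 -mulNr.
  exact: dvdp_mull.
have [b bP] := choice inv.
have [y yP] : exists y, forall n, I n (y - emb (b n)).
  apply: ideal_cauchy => n; rewrite -rmorphB; apply/ideal_emb.
  rewrite -(@Gauss_dvdpr _ _ a) ?coprimep_expl // mulrBr.
  have -> : a * b n.+1 - a * b n = (a * b n.+1 - 1) - (a * b n - 1) by ring.
  by apply: dvdp_sub (bP n); apply: dvdp_trans (bP _); rewrite exprS dvdp_mull.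
exists y; apply/eqP; rewrite -subr_eq0; apply/eqP/ideal_separated => n.
apply: (@ideal_trans _ _ _ _ (emb a * emb (b n))).
  by rewrite -mulrBr; apply: idealMl.
by rewrite -rmorphM -[1](rmorph1 emb) -rmorphB; apply/ideal_emb.
Qed.

(** The part of [a] prime to [v] becomes a unit. Applied to D_t, this bounds the denominator of E_t
    by a power of [pi]. *)
Lemma emb_dvd_piX a : a != 0 -> exists m w, emb a * w = pi ^+ m.
Proof.
have [n] := ubnP (size a); elim: n a => // n IH a sa a0.
case: (boolP (v %| a)) => [/dvdpP [b ab]|nva]; last first.
  have [w wP] : exists w, emb a * w = 1.
    by apply: emb_unit; rewrite irredp_coprimep.
  by exists 0%N, w.
have b0 : b != 0 by apply: contraNneq a0 => b0; rewrite ab b0 mul0r.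
have sb : (size b < n)%N.
  move: sa; rewrite ab size_mul ?v_neq0 // ltnS; apply: leq_trans.
  by case: v_irr; case: (size v) => [|[|s]] //= _ _;
    rewrite !addnS /= ltnS leq_addr.
have [m [w wP]] := IH b sb b0; exists m.+1, w.
by rewrite ab rmorphM /= mulrAC wP exprSr.
Qed.

(** * Integrality and continuity of the Carlitz functions E_t *)

Definition embF : {rmorphism {poly k} -> {fraction T}} := @FracField.tofrac T
  \o emb.

Lemma embF_inj : injective embF.
Proof. by move=> a b /eqP; rewrite /= tofrac_eq => /eqP /emb_inj. Qed.

Local Notation L := (cL embF p lam).

Lemma carlitz_seqE t : carlitz_seq v iota t = L t.
Proof. by rewrite (cL_carlitz embF_inj p_prime lam_gt0 card_k). Qed.

Definition carlitz_num t x : T := (map_poly emb (carlitz_e k t)).[x].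

Lemma cL_num t x : (emb (carlitz_D k t))%:F * (L t).[x%:F] = (carlitz_num t
  x)%:F.
Proof.
rewrite (cL_carlitz embF_inj p_prime lam_gt0 card_k) hornerZ mulrA mulfV ?mul1r.
  by rewrite -horner_map -map_poly_comp.
by rewrite tofrac_eq0 -(rmorph0 emb) (inj_eq emb_inj) carlitz_D_neq0.
Qed.

Lemma tofrac_inj : injective (@FracField.tofrac T).
Proof. by move=> x y /eqP; rewrite tofrac_eq => /eqP. Qed.

Lemma carlitz_num_ideal t x : exists z, carlitz_num t x = x * z.
Proof.
have /factor_theorem [g gE] : root (map_poly emb (carlitz_e k t)) 0.
  apply/eqP/tofrac_inj; rewrite -/(carlitz_num t 0) -cL_num tofrac0.
  by rewrite (cL0 embF card_k) mulr0.
exists (g.[x]); rewrite /carlitz_num gE hornerM hornerXsubC subr0 mulrC.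
by [].
Qed.

(** Since [x] divides e_t(x), a power of [pi] divisible by D_t absorbs the denominator. *)
Lemma cL_small_integral t : exists m, forall n z, exists y,
  (L t).[(pi ^+ (m + n) * z)%:F] = (pi ^+ n * y)%:F.
Proof.
have [m [w wP]] := emb_dvd_piX (carlitz_D_neq0 k t).
exists m => n z; have [y yP] := carlitz_num_ideal t (pi ^+ (m + n) * z).
exists (w * (z * y)); apply: (mulfI (_ : (emb (carlitz_D k t))%:F != 0)).
  by rewrite tofrac_eq0 -(rmorph0 emb) (inj_eq emb_inj) carlitz_D_neq0.
rewrite cL_num yP -tofracM exprD -wP; congr (_ %:F); ring.
Qed.

(** Write [x] as a polynomial plus a multiple of a high power of [pi]; E_t is additive and integral
    on both. *)
Lemma carlitz_integral t x : exists y, y%:F = (L t).[x%:F].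
Proof.
have [m mP] := cL_small_integral t.
have [a _ [z _ xa]] := emb_dense m x.
have [b bP] := cL_int embF_inj p_prime lam_gt0 card_k t a.
have [y yP] := mP 0%N z; exists (emb b + y).
have -> : x = emb a + pi ^+ (m + 0) * z by rewrite addn0 xa addrC subrK.
by rewrite !tofracD (cLD embF p_prime card_k) bP yP expr0 mul1r.
Qed.

Definition phi t x : T := projT1 (cid (carlitz_integral t x)).

Lemma phiE t x : (phi t x)%:F = (L t).[x%:F].
Proof. by rewrite /phi; case: cid. Qed.

Let pchT : p%:R = 0 :> T.
Proof. exact: (pchar_ext p_prime card_k (emb \o polyC)). Qed.

Lemma phiD t x y : phi t (x + y) = phi t x + phi t y.
Proof. by apply: tofrac_inj; rewrite !(tofracD, phiE) (cLD embF p_prime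
  card_k). Qed.

Lemma phi_eq0 t : phi t 0 = 0.
Proof. by apply: (addrI (phi t 0)); rewrite -phiD !addr0. Qed.

Lemma phiN t x : phi t (- x) = - phi t x.
Proof. by apply: (addrI (phi t x)); rewrite -phiD !subrr phi_eq0. Qed.

Lemma phi0 x : phi 0 x = x.
Proof. by apply: tofrac_inj; rewrite phiE hornerX. Qed.

Lemma phi_lead t a : (size a <= t.+1)%N -> phi t (emb a) = emb (a`_t)%:P.
Proof. by move=> sa; apply: tofrac_inj; rewrite phiE (cL_lead embF_inj p_prime
  lam_gt0 card_k sa). Qed.

Lemma phiZ t c x : phi t (emb c%:P * x) = emb c%:P * phi t x.
Proof.
apply: tofrac_inj; rewrite phiE !tofracM phiE.
exact: (cLZ embF card_k).
Qed.

Definition phi_pred t x := if t is s.+1 then phi s x else 0.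

Lemma phi_mulX t x : phi t (emb 'X * x) = emb 'X * phi t x + phi_pred t x ^+ q.
Proof.
apply: tofrac_inj; rewrite phiE tofracM tofracD tofracM tofracXn phiE.
rewrite (cL_theta embF_inj p_prime lam_gt0 card_k); congr (_ + _ ^+ _).
by case: t => [|t] /=; rewrite ?phiE ?tofrac0.
Qed.

Lemma phi_num t x : emb (carlitz_D k t) * phi t x = carlitz_num t x.
Proof. by apply: tofrac_inj; rewrite tofracM phiE cL_num. Qed.

Lemma phi_root t x : phi t x = 0 -> exists a, x = emb a.
Proof.
move=> px; have : root (L t) (x%:F) by rewrite /root -phiE px tofrac0.
move/(cL_root embF_inj p_prime lam_gt0 card_k) => [a /tofrac_inj ->].
by exists a.
Qed.

Lemma phi_ucont t : adic_ucont (phi t).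
Proof.
have [m mP] := cL_small_integral t.
move=> n; exists (m + n)%N => x y [z _ zE]; rewrite -phiN -phiD -zE.
have [w wE] := mP n z; exists w => //; apply: tofrac_inj.
by rewrite phiE -wE.
Qed.

(** For t < deg v the denominator D_t is prime to [v], while [v] divides e_t(v). *)
Lemma phi_v t : (t < d)%N -> I 1 (phi t pi).
Proof.
move=> td; have cvD : coprimep v (carlitz_D k t).
  apply: (big_ind (fun D => coprimep v D)) => [|a b ca cb|a /andP [/eqP sa _]];
    first exact: coprimep1.
    by rewrite coprimepMr ca.
  rewrite irredp_coprimep //; apply/negP => /dvdp_leq.
  rewrite -size_poly_gt0 sa => /(_ isT); move: td;
    rewrite -ltnS prednK ?size_poly_gt0 ?v_neq0 //.
  by rewrite ltnNge => /negP.
have [w wP] := emb_unit cvD.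
rewrite -[phi _ _]mul1r -wP mulrAC phi_num; apply: idealMr.
have [z ->] := carlitz_num_ideal t pi.
by exists z; rewrite // expr1.
Qed.

(** The multiplicativity C_(a x) = C_a C_x of the Carlitz module, read on the coefficient of
    tau^t. *)
Lemma phi_mul t a x :
  phi t (emb a * x) = \sum_(i < t.+1) phi i (emb a) * phi (t - i) x ^+ (q ^ i).
Proof.
have q_gt0 : (0 < q)%N := ltnW (pexp_gt1 p_prime lam_gt0).
elim/poly_ind: a t => [|a c IH] t.
  by rewrite rmorph0 mul0r phi_eq0 big1 // => i _; rewrite phi_eq0 mul0r.
have phiX i y : phi i ((emb a * emb 'X + emb c%:P) * y) =
    emb 'X * phi i (emb a * y) + phi_pred i (emb a * y) ^+ q + emb c%:P * phi i
      y.
  by rewrite mulrDl phiD phiZ -phi_mulX mulrA [emb 'X * _]mulrC.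
rewrite rmorphD rmorphM /= phiX.
under eq_bigr => i _ do
  rewrite -[emb a * emb 'X + emb c%:P]mulr1 phiX mulr1 !mulrDl -!mulrA.
rewrite !big_split /= -!mulr_sumr IH; congr (_ + _ + _).
  case: t => [|t].
    by rewrite big_ord1 /= expr0n gtn_eqF // mul0r.
  rewrite [RHS]big_ord_recl /= expr0n gtn_eqF // mul0r add0r IH.
  rewrite (big_morph _ (exprDn_pexp lam p_prime pchT) (_ : _ = 0)); last first.
    by rewrite expr0n gtn_eqF.
  by apply: eq_bigr => i _; rewrite exprMn -exprM -expnSr.
rewrite big_ord_recl /= subn0 expn0 expr1 phi0 mul1r big1 ?addr0 // => i _.
have := @phi_lead i.+1 1; rewrite size_poly1 rmorph1 => ->//.
by rewrite coefC /= polyC0 rmorph0 mul0r.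
Qed.

(** Expand one factor [pi] by [phi_mul]: terms with [i < d] vanish modulo [v] by [phi_v], the others
    by induction since [t - i] drops below [(n - 1) * d]. Hence E_t modulo [v] is periodic modulo
    v^n. *)
Lemma phi_vX t n z : (t < n * d)%N -> I 1 (phi t (pi ^+ n * z)).
Proof.
elim: n t z => [//|n IH] t z tn.
rewrite exprS -mulrA phi_mul; apply: ideal_sum => i _.
case: (ltnP i d) => [id|di]; first by apply: idealMr; apply: phi_v.
apply: idealMl; rewrite -(prednK (_ : (0 < q ^ i)%N)); last first.
  by rewrite !expn_gt0 prime_gt0.
rewrite exprS; apply: idealMr; apply: IH.
move: tn; rewrite mulSn; have := ltn_ord i; have d0 : (0 < d)%N.
  by rewrite -subn1 subn_gt0; case: v_irr.
by move: di d0; lia.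
Qed.

Let q_gt1 : (1 < q)%N := pexp_gt1 p_prime lam_gt0.
Let q_gt0 : (0 < q)%N := ltnW q_gt1.

(** * The series of G_i(x), image of the Dirac measure at x *)

Definition Gamma x : dpseries T := digit_prod q (fun t => phi t x).

Lemma digit_prod_frac (E : nat -> T) (P : nat -> {poly {fraction T}}) x i :
  (forall t, (E t)%:F = (P t).[x%:F]) ->
  (digit_prod q E i)%:F = (fPE q P i).[x%:F].
Proof.
move=> EP; rewrite /fPE /pE horner_prod /digit_prod rmorph_prod.
by apply: eq_bigr => t _ /=; rewrite tofracXn EP horner_exp.
Qed.

Lemma phi_frac t x : (phi t x)%:F = (carlitz_seq v iota t).[x%:F].
Proof. by rewrite carlitz_seqE phiE. Qed.

Lemma Gamma_frac x i : (Gamma x i)%:F = (carlitz_poly v iota i).[x%:F].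
Proof.
rewrite /carlitz_poly card_k; apply: digit_prod_frac => t; exact: phi_frac.
Qed.

Lemma carlitz_funE i : carlitz_fun i = (fun x => Gamma x i).
Proof.
apply/funext => x; apply: tofrac_inj; rewrite Gamma_frac.
apply: (@getPex _ [set y : T | y%:F = (carlitz_poly v iota i).[x%:F]]).
by exists (Gamma x i); apply: Gamma_frac.
Qed.

Lemma Gamma_ucont i : adic_ucont (fun x => Gamma x i).
Proof.
move=> n; have [m mP] := choice (fun t => phi_ucont t n).
exists (\max_(t < i.+1) m t)%N => x y Ixy; apply: ideal_prodB => t.
apply: idealXB; apply: mP; apply: ideal_le Ixy.
exact: (leq_bigmax (F := fun t : 'I_i.+1 => m t)).
Qed.

Lemma Gamma_congr i N x z : (i < q ^ (N * d))%N ->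
  I N z -> I 1 (Gamma (x + z) i - Gamma x i).
Proof.
move=> iN [w _ <-].
rewrite /Gamma !(digit_prod_widen p_prime lam_gt0 _ iN).
apply: ideal_prodB => t; apply: idealXB; rewrite phiD addrAC subrr add0r.
exact: phi_vX.
Qed.

Lemma GammaD x y : Gamma (x + y) = Gamma x * Gamma y.
Proof.
rewrite /Gamma -(digit_prodD p_prime lam_gt0 pchT); congr digit_prod.
by apply/funext => t; rewrite phiD.
Qed.

Lemma Gamma0 : Gamma 0 = 1.
Proof.
rewrite -[RHS](_ : digit_prod q (fun _ => 0 : T) = 1); last first.
  by apply/funext => i; rewrite digit_prod0.
by congr digit_prod; apply/funext => t; rewrite phi_eq0.
Qed.

(* A bisection argument: if f were not uniformly continuous, nested balls on *)
(* which it is not would shrink to a point of discontinuity.                 *)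
Lemma continuous_adic_ucont (f : T -> T) : continuous f -> adic_ucont f.
Proof.
move=> /adic_continuousP fc n.
pose good m x := exists M, forall y z,
  I m (y - x) -> I m (z - x) -> I M (z - y) -> I n (f z - f y).
suff [M MP] : good 0%N 0 by exists M => x y; apply: MP; apply: ideal_full.
apply: contrapT => bad0.
have step (mx : nat * T) : exists x', ~ good mx.1 mx.2 ->
    I mx.1 (x' - mx.2) /\ ~ good mx.1.+1 x'.
  case: mx => m x /=; apply: contrapT => /forallNP H; have gx := H 0.
  have {gx} bad : ~ good m x by apply: contra_not gx.
  apply: bad; have sub (a : {poly_d k}) : good m.+1 (x + pi ^+ m * emb a).
    have /not_implyP [_ /not_andP [|/contrapT //]] := H (x + pi ^+ m * emb a).
    by rewrite addrAC subrr add0r => /(_ (ideal_pi _ _)).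
  have [M MP] := choice sub.
  (* The finitely many sub-balls, one per residue modulo [v], share a modulus; [m.+1] keeps [z] in
     the sub-ball of [y]. *)
  exists (maxn m.+1 (\max_(a : {poly_d k}) M a)%N) => y z yx zx zy.
  have [w _ wE] := yx; have [a sa [w' _ w'E]] := emb_dense 1 w.
  rewrite mul1n in sa.
  have ya : I m.+1 (y - (x + pi ^+ m * emb (npolyp d a))).
    rewrite npolypK // opprD addrA -wE -mulrBr -w'E expr1 mulrA -exprSr.
    exact: ideal_pi.
  apply: (MP (npolyp d a)) => //.
    by apply: ideal_trans ya; apply: ideal_le zy; apply: leq_maxl.
  apply: ideal_le zy; apply: leq_trans (leq_maxr _ _).
  exact: (leq_bigmax (F := fun a : {poly_d k} => M a)).
have [F FP] := choice step.
pose xs := fix xs m := if m is m'.+1 then F (m', xs m') else 0.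
have bad m : ~ good m (xs m).
  by elim: m => [//|m IH]; have [] := FP (m, xs m) IH.
have [y yP] : exists y, forall m, I m (y - xs m).
  by apply: ideal_cauchy => m; have [] := FP (m, xs m) (bad m).
have [m mP] := fc y n; apply: (bad m); exists 0%N => z w zx wx _.
apply: (@ideal_trans _ _ _ _ (f y)); [|apply: idealNP]; apply: mP;
  by apply: ideal_trans (idealNP (yP m)).
Qed.

Lemma adic_ball_clopen n x : clopen (adic_ball n x).
Proof.
split.
  rewrite openE => y yx; apply/nbhs_adicP; exists n => z zy.
  exact: ideal_trans zy yx.
rewrite -openC openE => y yx; apply/nbhs_adicP; exists n => z zy zx; apply: yx.
exact: ideal_trans (idealNP zy) zx.
Qed.

Lemma clopen_locally (U : set T) x : clopen U ->
  exists m, forall y, I m (y - x) -> (U y <-> U x).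
Proof.
move=> [oU cU]; have [Ux|nUx] := pselect (U x).
  have /nbhs_adicP [m mU] : nbhs x U by apply: open_nbhs_nbhs.
  by exists m => y /mU.
have /nbhs_adicP [m mU] : nbhs x (~` U).
  by apply: open_nbhs_nbhs; split => //; rewrite openC.
by exists m => y /mU.
Qed.

Lemma clopen_shift (U : set T) y : clopen U -> clopen [set x | U (x + y)].
Proof.
move=> cU; split.
  rewrite openE => x Ux; apply/nbhs_adicP;
    have [m mP] := clopen_locally (x + y) cU.
  exists m => z zx; apply/mP => //.
  by rewrite opprD addrACA subrr addr0.
rewrite -openC openE => x Ux; apply/nbhs_adicP;
  have [m mP] := clopen_locally (x + y) cU.
exists m => z zx Uz; apply: Ux; apply/(mP (z + y)) => //.
by rewrite opprD addrACA subrr addr0.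
Qed.

(** * Discrete measures *)

Implicit Types (s : seq (T * {poly k})) (mu nu : set T -> T).

(** The points are kept as polynomials so that their degrees can be bounded, as in [spanned]. *)
Definition dmeas s : set T -> T :=
  fun U => \sum_(z <- s) z.1 * dirac_measure (emb z.2) U.

Definition dint s (f : T -> T) : T := \sum_(z <- s) z.1 * f (emb z.2).

(* Restricted to clopen sets because convolution loses control of the others. *)
Definition represents mu s : Prop := forall U, clopen U -> mu U = dmeas s U.

Lemma dmeas_measure s : is_measure (dmeas s).
Proof.
move=> U V oU cU oV cV UV0; rewrite /dmeas -big_split /=; apply: eq_bigr => z _.
by rewrite (@is_measure_dirac _ _ (emb z.2) U V) // mulrDr.
Qed.

(** Balls are clopen, so the Riemann sums of [mu] are combinations of those of Dirac measures, which
    sample [f] near each point; uniform continuity concludes. *)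
Lemma adic_integral_dmeas mu s f : represents mu s -> continuous f ->
  adic_integral mu f = dint s f.
Proof.
move=> ms fc; apply: cvg_lim; first exact: (completion_hausdorff v_compl).
move=> A /nbhs_adicP [n nA]; have [m mP] := continuous_adic_ucont fc n.
exists m => // N /= mN; apply: nA; rewrite /adic_ball /=.
have -> : riemann_sum mu f N =
    \sum_(z <- s) z.1 * riemann_sum (dirac_measure (emb z.2)) f N.
  under [RHS]eq_bigr do rewrite mulr_sumr.
  rewrite exchange_big; apply: eq_bigr => a _ /=.
  rewrite ms; last exact: adic_ball_clopen.
  by rewrite mulr_sumr; apply: eq_bigr => z _; rewrite mulrCA.
rewrite -sumrB; apply: ideal_sum => z _; rewrite -mulrBr; apply: idealMl.
have [b bz ->] := riemann_sum_dirac v_neq0 v_compl (emb z.2) f N.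
by apply: mP; apply: ideal_le bz.
Qed.

Definition dconv s s' : seq (T * {poly k}) :=
  [seq (r.1 * r'.1, r.2 + r'.2) | r <- s, r' <- s'].

Lemma dint_conv s s' f : dint (dconv s s') f =
  \sum_(z <- s) \sum_(z' <- s') z.1 * z'.1 * f (emb z.2 + emb z'.2).
Proof.
rewrite /dint /dconv big_allpairs_dep; apply: eq_bigr => z _.
by apply: eq_bigr => z' _; rewrite rmorphD.
Qed.

(** For clopen [U] the integrand is locally constant, hence continuous, and [adic_integral_dmeas]
    applies. *)
Lemma represents_conv mu nu s s' : represents mu s -> represents nu s' ->
  represents (convolution mu nu) (dconv s s').
Proof.
move=> ms ns' U cU; rewrite /convolution.
have -> : (fun y => mu [set x | U (x + y)]) =
    (fun y => \sum_(z <- s) z.1 * dirac_measure (emb z.2 + y) U).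
  by apply/funext => y; rewrite ms //; apply: clopen_shift.
rewrite (adic_integral_dmeas ns').
  rewrite [RHS](dint_conv s s' (fun x => dirac_measure x U)) exchange_big.
  apply: eq_bigr => z' _; rewrite mulr_sumr; apply: eq_bigr => z _ /=.
  by rewrite mulrCA mulrA.
apply/adic_continuousP => x n.
have [m mP] := choice (fun z : T * {poly k} => clopen_locally (emb z.2 + x) cU).
exists (\max_(z <- s) m z)%N => y yx.
rewrite -sumrB big_seq; apply: ideal_sum => z zs.
have zm : (m z <= \max_(z <- s) m z)%N by apply: leq_bigmax_seq.
have /(mP z) Uyx : I (m z) (emb z.2 + y - (emb z.2 + x)).
  by rewrite opprD addrACA subrr add0r; apply: ideal_le yx.
rewrite (_ : dirac_measure _ U = dirac_measure (emb z.2 + x) U).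
  by rewrite subrr; apply: ideal_zero.
rewrite /dirac_measure !indicE; congr (_%:R); congr (nat_of_bool _).
by apply/idP/idP => /set_mem H; apply/mem_set/Uyx.
Qed.

Lemma represents_dirac0 : represents (dirac_measure 0) [:: (1, 0)].
Proof. by move=> U _; rewrite /dmeas big_seq1 /= mul1r rmorph0. Qed.

Definition dseries s : dpseries T := fun i => dint s (fun x => Gamma x i).

Lemma measure_series_represents mu s : represents mu s -> measure_series mu =
  dseries s.
Proof.
move=> ms; apply/funext => i; rewrite /measure_series carlitz_funE.
rewrite (adic_integral_dmeas ms) //.
exact/adic_ucont_continuous/Gamma_ucont.
Qed.

Definition dpconst c : dpseries T := fun i => if i == 0%N then c else 0.

Lemma dpconstM c (f : dpseries T) i : (dpconst c * f) i = c * f i.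
Proof.
rewrite dpME big_ord_recl /= subn0 bin0 big1 ?addr0 // => j _.
by rewrite mul0r mul0rn.
Qed.

Definition dpX n : dpseries T := fun i => (i == n)%:R.

Lemma dpX_expand M (f : dpseries T) : (forall i, (M <= i)%N -> f i = 0) ->
  f = \sum_(i < M) dpconst (f i) * dpX i.
Proof.
move=> f0; apply/funext => j; rewrite dp_sumE.
under eq_bigr do rewrite dpconstM /dpX.
case: (ltnP j M) => jM; last first.
  by rewrite f0 // big1 // => i _; rewrite gtn_eqF ?mulr0 // (leq_trans _ jM).
rewrite (bigD1 (Ordinal jM)) //= eqxx mulr1 big1 ?addr0 // => i.
by rewrite -val_eqE /= eq_sym => /negbTE ->; rewrite mulr0.
Qed.

Lemma dseriesE s : dseries s = \sum_(r <- s) dpconst r.1 * Gamma (emb r.2).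
Proof.
apply/funext => i; rewrite dp_sumE /dseries /dint.
by apply: eq_bigr => r _; rewrite dpconstM.
Qed.

Lemma dseries_conv s s' : dseries (dconv s s') = dseries s * dseries s'.
Proof.
rewrite !dseriesE big_allpairs_dep mulr_suml; apply: eq_bigr => r _.
rewrite mulr_sumr; apply: eq_bigr => r' _; rewrite /= rmorphD GammaD mulrACA.
congr (_ * _); apply/funext => i; rewrite dpconstM /dpconst.
by case: ifP; rewrite ?mulr0.
Qed.

(** * Finite series as series of combinations of Dirac measures *)

Definition spanned n (f : dpseries T) : Prop :=
  exists2 s, all (fun r : T * {poly k} => size r.2 <= n)%N s & dseries s = f.

Lemma spanned_le m n f : (m <= n)%N -> spanned m f -> spanned n f.
Proof.
move=> mn [s sm sf]; exists s => //; apply: sub_all sm => r rm.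
exact: leq_trans rm mn.
Qed.

Lemma spanned_Gamma n a : (size a <= n)%N -> spanned n (Gamma (emb a)).
Proof.
move=> sa; exists [:: (1, a)]; first by rewrite /= sa.
by apply/funext => i; rewrite /dseries /dint big_seq1 mul1r.
Qed.

Lemma spannedM n f g : spanned n f -> spanned n g -> spanned n (f * g).
Proof.
move=> [s sn <-] [s' sn' <-]; exists (dconv s s'); last exact: dseries_conv.
apply/allP => _ /allpairsP [[r r'] [/= rs rs' ->]] /=.
by rewrite (leq_trans (size_polyD _ _)) // geq_max (allP sn) ?(allP sn').
Qed.

Lemma spanned_const n c f : spanned n f -> spanned n (dpconst c * f).
Proof.
apply: spannedM; exists [:: (c, 0)]; first by rewrite /= size_poly0.
by rewrite dseriesE big_seq1 /= rmorph0 Gamma0 mulr1.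
Qed.

Lemma spanned_sum n (J : Type) (r : seq J) (P : pred J) (F : J -> dpseries T) :
  (forall j, P j -> spanned n (F j)) -> spanned n (\sum_(j <- r | P j) F j).
Proof.
move=> FP; apply: big_ind => //.
  by exists [::] => //; rewrite dseriesE big_nil.
move=> _ _ [s sn <-] [s' sn' <-]; exists (s ++ s'); first by rewrite all_cat sn.
by rewrite !dseriesE big_cat.
Qed.

Lemma digit_prod_fin n (E : nat -> T) : (forall t, (n <= t)%N -> E t = 0) ->
  digit_prod q E = \prod_(t < n) digit_prod q (only E t).
Proof.
move=> E0; apply/funext => i; set M := maxn n i.+1.
have iM : (i < q ^ M)%N.
  apply: ltn_trans (ltn_expl i q_gt1) _; rewrite ltn_exp2l //.
  exact: leq_maxr.
have <- : (\prod_(t < M) digit_prod q (only E t)) i = digit_prod q E i.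
  by rewrite prod_digit_prod_only // iM.
have nM : (n <= M)%N by apply: leq_maxl.
rewrite -!(big_mkord xpredT (fun t => digit_prod q (only E t))).
rewrite (big_cat_nat (n := n)) //= [X in _ * X]big_nat_cond [X in _ * X]big1
  ?mulr1 //.
move=> t; rewrite andbT => /andP [nt _]; apply/funext => j.
rewrite -[RHS](digit_prod0 T p_prime lam_gt0); congr (digit_prod q _ j).
by apply/funext => u; rewrite /only E0 //; case: ifP.
Qed.

(** Weights on [k] that extract one power, by inverting the Vandermonde matrix of all elements of
    [k]. *)
Lemma power_interpolation m : (m < #|k|)%N -> exists u : k -> k,
  forall l, (l < #|k|)%N -> \sum_c u c * c ^+ l = (l == m)%:R.
Proof.
move=> mk; pose V := Vandermonde #|k| (\row_(j < #|k|) (enum_val (j : 'I_#|{: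
  k}|) : k)).
have Vu : V \in unitmx.
  rewrite unitmxE det_Vandermonde unitfE; apply/prodf_neq0 => i _.
  apply/prodf_neq0 => j ij; rewrite !mxE subr_eq0 (inj_eq enum_val_inj).
  by rewrite neq_ltn ij orbT.
pose w := invmx V *m delta_mx (Ordinal mk) (0 : 'I_1).
exists (fun c => w (enum_rank c) 0) => l lk.
have : (V *m w) (Ordinal lk) 0 = (l == m)%:R.
  by rewrite mulmxA mulmxV // mul1mx mxE eqxx andbT -val_eqE.
rewrite mxE => <-; rewrite (reindex (@enum_val k k)) /=; last first.
  by exists enum_rank => i _; rewrite ?enum_valK ?enum_rankK.
by apply: eq_bigr => i _; rewrite enum_valK !mxE mulrC.
Qed.

(** Splitting off the top digit reduces to D_(m Q) with m < q. The n-th factor [g c] of the Dirac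
    measure at c theta^n is the sum of the c^l D_(l Q), l < q, so a Vandermonde combination over [c]
    isolates D_(m Q). *)
Lemma spanned_dpX n i : (i < q ^ n)%N -> spanned n (dpX i).
Proof.
elim: n i => [|n IH] i.
  rewrite expn0 ltnS leqn0 => /eqP ->.
  have -> : dpX 0 = Gamma (emb 0) by rewrite rmorph0 Gamma0.
  by apply: spanned_Gamma; rewrite size_poly0.
move=> iq; set Q := (q ^ n)%N; have Q_gt0 : (0 < Q)%N by rewrite expn_gt0 q_gt0.
have -> : dpX i = dpX (i %% Q)%N * dpX (i %/ Q * Q)%N.
  apply/funext => j; rewrite (dpmul_disjoint p_prime lam_gt0 pchT (n := n)).
  - rewrite /dpX -natrM mulnb; congr (_%:R); congr nat_of_bool.
    apply/eqP/andP => [-> //|[/eqP jm /eqP jd]].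
    by rewrite (divn_eq j Q) jm jd -divn_eq.
  - by move=> l Ql; rewrite /dpX gtn_eqF // (leq_trans _ Ql) // ltn_mod.
  - move=> l; rewrite /dpX; case: eqP => // ->; by rewrite dvdn_mull.
apply: spannedM; first by apply: spanned_le (IH _ _) => //; rewrite ltn_mod.
have mq : (i %/ Q < q)%N by rewrite ltn_divLR // -expnS.
move: (i %/ Q)%N mq => m mq.
pose E c t := phi t (emb (c *: 'X^n)).
pose g c : dpseries T := digit_prod q (only (E c) n).
have gP c : spanned n.+1 (g c).
  (* the factors of index < n of the Dirac measure at - c theta^n *)
  pose h : dpseries T := \prod_(t < n) digit_prod q (only (fun u => - E c u) t).
  have -> : g c = Gamma (emb (c *: 'X^n)) * h.
    have GE : Gamma (emb (c *: 'X^n)) = \prod_(t < n.+1) digit_prod q (only (E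
      c) t).
      apply: digit_prod_fin => t nt.
      rewrite /E phi_lead; last first.
        apply: leq_trans (size_scale_leq _ _) _.
        by rewrite size_polyXn ltnS ltnW.
      by rewrite coefZ coefXn gtn_eqF // mulr0 rmorph0.
    (* Factors with opposite entries are mutually inverse by [digit_prodD], so only the n-th one
       remains. *)
    rewrite GE big_ord_recr /= mulrAC -big_split /= big1 ?mul1r // => t _.
    rewrite -(digit_prodD p_prime lam_gt0 pchT).
    apply/funext => j; rewrite -[RHS](digit_prod0 T p_prime lam_gt0).
    congr (digit_prod q _ j); apply/funext => u; rewrite /only.
    by case: ifP; rewrite ?subrr ?addr0.
  apply: spannedM.
    apply: spanned_Gamma; apply: leq_trans (size_scale_leq _ _) _.
    by rewrite size_polyXn.
  rewrite (@dpX_expand Q h); last first.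
    by move=> j; rewrite leqNgt /h prod_digit_prod_only // => /negbTE ->.
  apply: spanned_sum => j _; apply: spanned_const.
  by apply: spanned_le (IH _ (ltn_ord j)).
have gE c j : g c j = if (Q %| j)%N && (j < q ^ n.+1)%N
    then emb (c ^+ (j %/ Q))%:P else 0.
  rewrite /g digit_prod_only //; case: ifP => // _; rewrite /E phi_lead.
    by rewrite coefZ coefXn eqxx mulr1 -rmorphXn /= -polyC_exp.
  by apply: leq_trans (size_scale_leq _ _) _; rewrite size_polyXn.
have [u uP] : exists u : k -> k,
  forall l, (l < q)%N -> \sum_c u c * c ^+ l = (l == m)%:R.
  by rewrite -card_k; apply: power_interpolation; rewrite card_k.
have -> : dpX (m * Q)%N = \sum_c dpconst (emb (u c)%:P) * g c.
  apply/funext => j; rewrite dp_sumE.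
  under eq_bigr do rewrite dpconstM gE.
  case: (boolP (_ && _)) => [/andP [/dvdnP [l ->] lq]|nj].
    transitivity (\sum_c emb (u c * c ^+ l)%:P); last first.
      by apply: eq_bigr => c _; rewrite mulnK // polyCM rmorphM.
    rewrite -(rmorph_sum emb) -(rmorph_sum polyC) uP; last first.
      by rewrite -(ltn_pmul2r Q_gt0) -expnS.
    rewrite /dpX eqn_pmul2r //.
    by case: eqP => _ /=; rewrite ?polyC0 ?rmorph0 ?rmorph1.
  rewrite big1 => [|c _]; last by rewrite mulr0.
  rewrite /dpX; case: eqP => // jE; move: nj.
  by rewrite jE dvdn_mull //= expnS ltn_pmul2r // mq.
by apply: spanned_sum => c _; apply: spanned_const.
Qed.

Lemma spanned_finite n (f : dpseries T) : (forall i, (q ^ n <= i)%N -> f i = 0)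
  ->
  spanned n f.
Proof.
move=> /dpX_expand ->; apply: spanned_sum => i _; apply: spanned_const.
exact: spanned_dpX.
Qed.

(* The measures mapped to the D_i are dual to the Carlitz polynomials; as the *)
(* matrix (G_i(a)) is square, this inverts the interpolation problem.        *)
Lemma Gamma_interpolation n (f : {poly k} -> T) : exists c : nat -> T,
  forall a, (size a <= n)%N -> f a = \sum_(i < q ^ n) c i * Gamma (emb a) i.
Proof.
have /choice [s sP] : forall i, exists s, (i < q ^ n)%N ->
    all (fun r : T * {poly k} => size r.2 <= n)%N s /\ dseries s = dpX i.
  move=> i; case: (ltnP i (q ^ n)) => [/spanned_dpX [s s1 s2]|_];
    first by exists s.
  by exists [::].
have cardN : #|{: {poly_n k}}| = (q ^ n)%N by rewrite card_npoly card_k.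
set N := #|_| in cardN.
pose pt (j : 'I_N) : {poly k} := (enum_val j : {poly_n k}).
pose W : 'M[T]_N := \matrix_(i, j) \sum_(r <- s i | r.2 == pt j) r.1.
pose G : 'M[T]_N := \matrix_(j, i) Gamma (emb (pt j)) i.
have ptP a : (size a <= n)%N -> exists2 j, pt j = a & forall j', (a == pt j') =
  (j' == j).
  move=> sa; exists (enum_rank (npolyp n a)) => [|j'].
    by rewrite /pt enum_rankK npolypK.
  apply/eqP/eqP => [aE|->]; last by rewrite /pt enum_rankK npolypK.
  apply: enum_val_inj; rewrite enum_rankK; apply/val_inj => /=.
  by rewrite npolypK // aE.
have WG : W *m G = 1%:M.
  apply/matrixP => i j; rewrite !mxE.
  have iN : (i < q ^ n)%N by rewrite -cardN.
  have [sn sE] := sP i iN.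
  have -> : (i == j)%:R = dseries (s i) j by rewrite sE /dpX -val_eqE eq_sym.
  rewrite /dseries /dint.
  under eq_bigr do rewrite !mxE big_mkcond mulr_suml.
  rewrite exchange_big /= !big_seq; apply: eq_bigr => r rs.
  have [j0 j0E j0P] := ptP _ (allP sn r rs).
  rewrite (bigD1 j0) //= j0P eqxx j0E big1 ?addr0 // => j' nj'.
  by rewrite j0P (negbTE nj') mul0r.
have GW := mulmx1C WG.
(* The coefficients are [W] applied to the values of [f], padded with 0 beyond [N]. *)
exists (fun i => if insub i is Some i' then \sum_j W i' j * f (pt j) else 0) =>
  a sa.
have [j0 j0E j0P] := ptP a sa.
transitivity (\sum_(i < N) G j0 i * \sum_j W i j * f (pt j)); last first.
  rewrite -cardN; apply: eq_bigr => i _.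
  rewrite valK mulrC; congr (_ * _).
  by rewrite mxE j0E.
under eq_bigr do rewrite mulr_sumr.
rewrite exchange_big /= (bigD1 j0) //= [X in _ + X]big1 ?addr0 => [|j nj].
  under eq_bigr do rewrite mulrA.
  rewrite -mulr_suml (_ : \sum_i _ = (G *m W) j0 j0); last by rewrite mxE.
  by rewrite GW mxE eqxx mul1r j0E.
under eq_bigr do rewrite mulrA.
rewrite -mulr_suml (_ : \sum_i _ = (G *m W) j0 j); last by rewrite mxE.
by rewrite GW mxE eq_sym (negbTE nj) mul0r.
Qed.

(** * Uniform approximation by Carlitz polynomials and weak convergence *)

Definition gcomb (c : seq (T * nat)) x : T := \sum_(r <- c) r.1 * Gamma x r.2.

Lemma gcomb_ucont c : adic_ucont (gcomb c).
Proof.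
move=> n; have [m mP] := choice (fun i => Gamma_ucont i n).
exists (\max_(r <- c) m r.2)%N => x y yx; rewrite -sumrB big_seq.
apply: ideal_sum => r rc; rewrite -mulrBr; apply: idealMl; apply: mP.
by apply: ideal_le yx; apply: (leq_bigmax_seq (F := fun r : T * nat => m r.2)).
Qed.

(** Interpolate [f] at the polynomials of degree < N deg v, where N is a modulus for [f] modulo [v].
    The interpolant is v^N-periodic modulo [v] by [Gamma_congr], so the agreement modulo [v] spreads
    to all points. *)
Lemma gcomb_approx1 (f : T -> T) : continuous f -> exists c f',
  continuous f' /\ forall x, f x = gcomb c x + pi * f' x.
Proof.
move=> fc; have fu := continuous_adic_ucont fc.
have [N NP] := fu 1%N.
have [c cP] := Gamma_interpolation (N * d) (fun a => f (emb a)).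
pose g := gcomb [seq (c i, i) | i <- index_iota 0 (q ^ (N * d))%N].
have gE x : g x = \sum_(i < q ^ (N * d)) c i * Gamma x i.
  by rewrite /g /gcomb big_map /= big_mkord.
have fg x : I 1 (f x - g x).
  have [a sa xa] := emb_dense N x.
  apply: (@ideal_trans _ _ _ _ (f (emb a))); first exact: NP.
  rewrite cP // gE -sumrB; apply: ideal_sum => i _; rewrite -mulrBr;
    apply: idealMl.
  have -> : emb a = x + (emb a - x) by rewrite addrC subrK.
  by apply: (@Gamma_congr _ N) => //; apply: idealNP.
have /choice [f' f'E] : forall x, exists y, f x - g x = pi * y.
  by move=> x; have [y _ yE] := fg x; exists y; rewrite -yE expr1.
exists [seq (c i, i) | i <- index_iota 0 (q ^ (N * d))%N], f'; split;
  last first.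
  by move=> x; rewrite -f'E -/g addrC subrK.
apply/adic_continuousP => x n.
(* Precision [n.+1] is requested because one factor [pi] is cancelled in [f']. *)
have [m mP] := fu n.+1.
have [m' mP'] := @gcomb_ucont [seq (c i, i) | i <- index_iota 0 (q ^ (N *
  d))%N] n.+1.
exists (maxn m m') => y yx; apply: (@ideal_cancel _ _ 1); first exact: pi_neq0.
rewrite expr1 mulrBr -[X in X - _]f'E -[X in _ - X]f'E.
have -> : f y - g y - (f x - g x) = (f y - f x) - (g y - g x) by ring.
by apply: idealB; [apply: mP|apply: mP']; apply: ideal_le yx;
  rewrite ?leq_maxl ?leq_maxr.
Qed.

Lemma gcomb_approx m (f : T -> T) : continuous f ->
  exists c, forall x, I m (f x - gcomb c x).
Proof.
elim: m f => [|m IH] f fc; first by exists [::] => x; apply: ideal_full.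
have [c [f' [f'c fE]]] := gcomb_approx1 fc.
have [c' c'P] := IH f' f'c.
exists (c ++ [seq (pi * r.1, r.2) | r <- c']) => x.
have [y _ yE] := c'P x.
rewrite /gcomb big_cat big_map /= -/(gcomb c x).
under eq_bigr do rewrite -mulrA.
rewrite -mulr_sumr -/(gcomb c' x) fE opprD addrACA subrr add0r -mulrBr -yE.
by rewrite mulrA -exprS; apply: ideal_pi.
Qed.

Lemma dint_gcomb s c : dint s (gcomb c) = \sum_(r <- c) r.1 * dseries s r.2.
Proof.
rewrite /dint /dseries /dint.
under eq_bigr do rewrite mulr_sumr.
rewrite exchange_big; apply: eq_bigr => r _; rewrite mulr_sumr.
by apply: eq_bigr => z _; rewrite mulrCA.
Qed.

(** Replacing [f] by a close [gcomb] costs an error in the same ideal whatever [s n] is, its weights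
    being integral; a [gcomb] involves finitely many coefficients, all eventually exact. *)
Lemma dint_weak_cvg (s : nat -> seq (T * {poly k})) x (f : T -> T) :
  (forall i, \forall n \near \oo, dseries (s n) i = Gamma x i) ->
  continuous f -> (fun n => dint (s n) f) @ \oo --> f x.
Proof.
move=> sx fc A /nbhs_adicP [m mA]; have [c cP] := gcomb_approx m fc.
have [N NP] := choice (fun i => let: ex_intro2 N _ NP := sx i in ex_intro _ N
  NP).
exists (\max_(r <- c) N r.2)%N => // n /= Nn; apply: mA; rewrite /adic_ball /=.
apply: (@ideal_trans _ _ _ _ (dint (s n) (gcomb c))).
  by rewrite /dint -sumrB; apply: ideal_sum => r _; rewrite -mulrBr;
    apply: idealMl.
rewrite dint_gcomb (_ : \sum_(r <- c) _ = gcomb c x); first exact: idealNP.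
rewrite /gcomb !big_seq; apply: eq_bigr => r rc; congr (_ * _); apply: NP => /=.
by apply: leq_trans Nn; apply: (leq_bigmax_seq (F := fun r : T * nat => N r.2)).
Qed.

(** The iterated convolution is a right fold, so the induction peels off the first measure and
    shifts the sequence. *)
Lemma represents_big (mu : nat -> set T -> T) (s : nat -> seq (T * {poly k})) n
  :
  (forall t, represents (mu t) (s t)) -> exists S,
    represents (partial_convolution mu n) S /\
    dseries S = \prod_(t < n) dseries (s t).
Proof.
rewrite /partial_convolution; elim: n mu s => [|n IH] mu s ms.
  exists [:: (1, 0)]; rewrite !big_ord0; split; first exact: represents_dirac0.
  rewrite dseriesE big_seq1 /= rmorph0 Gamma0 mulr1.
  by apply/funext => i; rewrite /dpconst dp1E; case: eqP.
have [S [rS dS]] := IH (mu \o S) (s \o S) (fun t => ms t.+1).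
exists (dconv (s 0%N) S); rewrite !big_ord_recl; split.
  by apply: represents_conv.
by rewrite dseries_conv dS.
Qed.

Lemma measure_series_dirac x : measure_series (dirac_measure x) = Gamma x.
Proof.
apply/funext => i; rewrite /measure_series carlitz_funE adic_integral_dirac //.
  exact: v_neq0.
exact/adic_ucont_continuous/Gamma_ucont.
Qed.

Lemma carlitz_BD_single t : BD_single q (fPE q (only (carlitz_seq v iota) t)).
Proof.
exists (only (carlitz_seq v iota) t); split=> // [s|].
  rewrite /only; case: ifP => _; last first.
    by exists 0%N, (fun _ => 0); rewrite big_ord0.
  by rewrite carlitz_seqE; apply: cL_qlinear card_k _.
exists t; split=> [|s]; rewrite /only ?eqxx; last by case: eqP.
rewrite carlitz_seqE => /eqP; apply/negP.
by rewrite -size_poly_gt0 (size_cL embF_inj p_prime lam_gt0).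
Qed.

(** The coefficient at q^t is E_t(x), which vanishes only at polynomials. *)
Lemma digit_prod_only_neq1 x t : ~ range iota x ->
  digit_prod q (only (fun u => phi u x) t) <> 1.
Proof.
move=> nx /(congr1 (fun f : dpseries T => f (q ^ t)%N)).
rewrite digit_prod_only // dvdnn ltn_exp2l // ltnSn divnn !expn_gt0 prime_gt0
  //= expr1.
rewrite dp1E gtn_eqF ?expn_gt0 ?prime_gt0 // => /phi_root [a xa].
by apply: nx; exists a.
Qed.

End Completion.

(** * Assembly of the product decompositions and the infinite convolution *)

Theorem mainTheorem9 (p lambda q : nat) (k : finFieldType)
    (p_prime : prime p) (lambda_ge1 : (1 <= lambda)%N)
    (q_def : q = (p ^ lambda)%N) (card_k : #|k| = q) :
  (forall (F : fieldType) (j : {rmorphism k -> F}) (f : dpseries {poly F}),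
     BD q f ->
     exists (S : pred nat) (g : nat -> dpseries {poly F}),
       (forall t, S t -> BD_single q (g t)) /\
       (fun n => \prod_(t < n | S t) g t) @ \oo --> f)
  /\
  (forall (v : {poly k}) (Av : idomainType) (iota : {rmorphism {poly k} -> Av}),
     irreducible_poly v -> is_completion v iota ->
     forall alpha : adic (iota v),
     let delta : set (adic (iota v)) -> adic (iota v) := dirac_measure alpha in
     let E := carlitz_seq v iota in
     (forall i, FracField.tofrac (measure_series delta i) =
        (fPE q E i).[FracField.tofrac alpha]) /\
     exists g : nat -> dpseries (adic (iota v)),
       [/\ forall t, BD_single q (fPE q (only E t)),
           forall t i, FracField.tofrac (g t i) =
             (fPE q (only E t) i).[FracField.tofrac alpha],
           (fun n => \prod_(t < n) g t) @ \oo --> measure_series delta,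
           ~ range iota alpha -> infinite_set [set t | g t <> 1] &
           exists mu : nat -> set (adic (iota v)) -> adic (iota v),
             [/\ forall t, is_measure (mu t),
                 forall t, measure_series (mu t) = g t,
                 forall n, measure_series (partial_convolution mu n) =
                   \prod_(t < n) g t &
                 forall f : adic (iota v) -> adic (iota v), continuous f ->
                   (fun n => adic_integral (partial_convolution mu n) f) @ \oo -->
                     adic_integral delta f]]).
Proof.
subst q; set q := (p ^ lambda)%N; split.
  move=> F j f [E E_lin ->]; have pF := pchar_ext p_prime card_k (polyC \o j).
  (* Zero entries contribute the factor 1 and are skipped, since a factor must come from a nonzero
     function. *)
  exists (fun t => E t != 0), (fun t => fPE q (only E t)); split=> [t Et0|].
    exists (only E t); split=> // [s|].
      rewrite /only; case: ifP => // _.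
      by exists 0%N, (fun _ => 0); rewrite big_ord0.
    exists t; split=> [|s]; rewrite /only ?eqxx; last by case: eqP.
    exact/eqP.
  have -> : (fun n => \prod_(t < n | E t != 0) fPE q (only E t)) =
      (fun n => \prod_(t < n) digit_prod q (only E t)).
    apply/funext => n; rewrite big_mkcond; apply: eq_bigr => t _.
    case: eqP => //= Et0; apply/funext => i.
    rewrite -[LHS](digit_prod0 {poly F} p_prime lambda_ge1).
    congr (digit_prod q _ i); apply/funext => s; rewrite /only.
    by case: eqP => // ->.
  exact: (prod_digit_prod_cvg p_prime lambda_ge1 pF).
move=> v Av iota v_irr v_compl alpha delta E.
have pT := pchar_ext p_prime card_k (@emb k v Av iota \o polyC).
pose ph t := phi p_prime lambda_ge1 card_k v_irr v_compl t.
have deltaE : measure_series delta = digit_prod q (ph^~ alpha).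
  exact: measure_series_dirac.
split=> [i|]; first by rewrite deltaE; apply: digit_prod_frac => t;
  apply: phi_frac.
pose g t := digit_prod q (only (ph^~ alpha) t).
have /choice [s sP] : forall t, exists s : seq (adic (iota v) * {poly k}),
    dseries p_prime lambda_ge1 card_k v_irr v_compl s = g t.
  move=> t; suff [s _ sE] : spanned p_prime lambda_ge1 card_k v_irr v_compl
    t.+1 (g t) by exists s.
  (* The t-th factor has no term of index q^(t+1) or more. *)
  apply: spanned_finite => i; rewrite leqNgt /g digit_prod_only //.
  by case: andP => // -[_ ->].
exists g; split.
- by move=> t; apply: carlitz_BD_single.
- move=> t i; apply: digit_prod_frac => u; rewrite /only.
  by case: ifP => _; [apply: phi_frac | rewrite tofrac0 horner0].
- by rewrite deltaE; apply: prod_digit_prod_cvg pT _.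
- move=> nalpha; rewrite (_ : [set t | _] = setT); first exact: infinite_nat.
  by apply/seteqP; split=> // t _; apply: digit_prod_only_neq1.
have /choice [S SP] : forall n, exists S, represents
    (partial_convolution (fun t => dmeas (s t)) n) S /\
    dseries p_prime lambda_ge1 card_k v_irr v_compl S = \prod_(t < n) g t.
  move=> n; have [S [rS dS]] := @represents_big _ _ _ _ _ _ p_prime lambda_ge1
    card_k v_irr v_compl _ s n (fun t U _ => erefl).
  by exists S; split; rewrite // dS; apply: eq_bigr => t _.
exists (fun t => dmeas (s t)); split.
- by move=> t; apply: dmeas_measure.
- move=> t; rewrite -sP; exact: measure_series_represents.
- by move=> n; have [rS <-] := SP n; apply: measure_series_represents.
move=> f fc; rewrite /delta (adic_integral_dirac (v_neq0 v_irr)) //.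
have -> : (fun n => adic_integral (partial_convolution (fun t => dmeas (s t))
  n) f) =
    (fun n => dint (S n) f).
  by apply/funext => n; have [rS _] := SP n; apply: adic_integral_dmeas rS fc.
apply: (@dint_weak_cvg _ _ _ _ _ _ p_prime lambda_ge1 card_k v_irr v_compl S
  alpha) => // i.
(* From [n = i] on, i < q^n, so the i-th coefficient of the partial product is already final. *)
exists i => // n /= iin; have [_ ->] := SP n.
rewrite (prod_digit_prod_only p_prime lambda_ge1 pT) ifT //.
by apply: leq_ltn_trans iin (ltn_expl _ (pexp_gt1 p_prime lambda_ge1)).
Qed.
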